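(* Let $T$ be a triangulation of the convex $(n+2)$-gon $\mathsf{P}_{n+2}$. Then the toric variety $X(\Sigma_T)$ is Fano.
   Context: Here $n\ge1$ and $[n]=\{1,\dots,n\}$. Let $\mathsf{P}_{n+2}$ be a convex $(n+2)$-gon with vertices labelled $0,1,\dots,n+1$ in counterclockwise order. A triangulation $T$ of $\mathsf{P}_{n+2}$ is a decomposition into $n$ triangles by $n-1$ diagonals not crossing in their interiors; $T$ is also regarded as the set of all edges of these triangles (sides and chosen diagonals). Put $e=\{0,n+1\}$, the distinguished edge. Define $F\colon T\setminus\{e\}\to\{\mathsf{L},\mathsf{R}\}$ recursively: for a triangulated polygon with distinguished edge $g$ (starting with $\mathsf{P}_{n+2}$ and $g=e$), the unique triangle containing $g$ has two other edges $f_{\mathsf{L}}(g),f_{\mathsf{R}}(g)$, named so that $f_{\mathsf{L}}(g),f_{\mathsf{R}}(g),g$ are placed counterclockwise; set $F(f_{\mathsf{L}}(g))=\mathsf{L}$, $F(f_{\mathsf{R}}(g))=\mathsf{R}$. Removing $g$ leaves two triangulated polygons (possibly single edges) with one common vertex and with distinguished edges $f_{\mathsf{L}}(g)$ and $f_{\mathsf{R}}(g)$; repeat for each of them that is not a single edge. The left tree $\mathcal{T}_T^{\mathsf{L}}$ has vertex set $\{0,\dots,n\}$, root $0$ and edge set $F^{-1}(\mathsf{L})$; the right tree $\mathcal{T}_T^{\mathsf{R}}$ has vertex set $\{1,\dots,n+1\}$, root $n+1$ and edge set $F^{-1}(\mathsf{R})$. For each $1\le k\le n$ there is exactly one edge $\{k_{\mathsf{L}},k\}$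 of $\mathcal{T}_T^{\mathsf{L}}$ with $k_{\mathsf{L}}<k$ and exactly one edge $\{k,k_{\mathsf{R}}\}$ of $\mathcal{T}_T^{\mathsf{R}}$ with $k<k_{\mathsf{R}}$; this defines $k_{\mathsf{L}},k_{\mathsf{R}}$. Let $N=\mathbb{Z}^{n+1}/\mathbb{Z}(1,\dots,1)$ and let $\varpi_i\in N$ be the image of $\sum_{k=1}^i e_k$ ($0\le i\le n+1$), so $\varpi_0=\varpi_{n+1}=0$. Put $\mathbf{v}_k=\varpi_k-\varpi_{k_{\mathsf{R}}}$ and $\mathbf{w}_k=\varpi_{k_{\mathsf{L}}}-\varpi_k$ for $k\in[n]$. $\Sigma_T$ is the complete non-singular fan in $N\otimes\mathbb{R}$ consisting of the cones $\operatorname{Cone}(Q)$ for subsets $Q\subset\{\mathbf{v}_k,\mathbf{w}_k\mid k\in[n]\}$ with $\{\mathbf{v}_i,\mathbf{w}_i\}\not\subset Q$ for all $i\in[n]$. $X(\Sigma_T)$ is the corresponding (smooth projective) toric variety over $\mathbb{C}$. Fano means that the anticanonical divisor is ample. *)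

(* Defs.v *)
From HB Require Import structures.
From mathcomp Require Import all_boot all_order all_algebra.
From mathcomp Require Import boolp classical_sets reals.
From mathcomp Require Import complex mpoly.

Set Implicit Arguments.
Unset Strict Implicit.
Unset Printing Implicit Defensive.

Import Order.TTheory GRing.Theory Num.Theory.

Local Open Scope classical_set_scope.
Local Open Scope ring_scope.

(** * Triangulations of the convex (n+2)-gon

  The vertices are 'I_n.+2; the edge {a, b} with a < b is the pair (a, b). *)

Section Triangulation.
Variable n : nat.

Definition edge := ('I_n.+2 * 'I_n.+2)%type.

Definition is_side (p : edge) : bool :=
  (p.2 == p.1.+1 :> nat) || (p == (ord0, ord_max)).

Definition crosses (p q : edge) : bool :=
  [&& (p.1 < q.1)%N, (q.1 < p.2)%N & (p.2 < q.2)%N].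

Definition is_triangulation (T : {set edge}) : Prop :=
  [/\ forall p, p \in T -> (p.1 < p.2)%N,
      forall p, is_side p -> p \in T,
      forall p q, p \in T -> q \in T -> ~~ crosses p q
    & #|[set p in T | ~~ is_side p]| = n.-1].

Variable T : {set edge}.

Definition is_triangle (a c b : 'I_n.+2) : Prop :=
  [/\ (a < c)%N, (c < b)%N, (a, b) \in T, (a, c) \in T & (c, b) \in T].

(* The edges that occur as distinguished edges during the recursion.  If     *)
(* {a, b} is distinguished, the polygon it cuts off has its vertices in      *)
(* [a, b], so the triangle containing {a, b} has its third vertex c in       *)
(* between.  The sides ac, cb, ba are placed counterclockwise, so that       *)
(* f_L = {a, c} and f_R = {c, b}.                                            *)
Inductive distinguished : 'I_n.+2 -> 'I_n.+2 -> Prop :=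
| dist_e : distinguished ord0 ord_max
| dist_L a c b : distinguished a b -> is_triangle a c b -> distinguished a c
| dist_R a c b : distinguished a b -> is_triangle a c b -> distinguished c b.

Definition labelled_L (a c : 'I_n.+2) : Prop :=
  exists2 b, distinguished a b & is_triangle a c b.

Definition labelled_R (c b : 'I_n.+2) : Prop :=
  exists2 a, distinguished a b & is_triangle a c b.

(* These sets are singletons when T is a triangulation and 1 <= k <= n.      *)
Definition leftv (k : 'I_n.+2) : 'I_n.+2 :=
  xget ord0 [set j : 'I_n.+2 | (j < k)%N /\ labelled_L j k].

Definition rightv (k : 'I_n.+2) : 'I_n.+2 :=
  xget ord0 [set j : 'I_n.+2 | (k < j)%N /\ labelled_R k j].

End Triangulation.

(** * The lattice N = Z^(n+1) / Z(1,...,1)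

  N is free of rank n; it is realised as Z^n through the surjection toN, whose
  kernel is Z(1,...,1).  In these coordinates varpi_1, ..., varpi_n is the
  standard basis. *)

Section Lattice.
Variable n : nat.

Definition toN (a : 'rV[int]_n.+1) : 'rV[int]_n :=
  \row_i (a ord0 (widen_ord (leqnSn n) i) - a ord0 (lift ord0 i)).

Lemma toN_ker (a : 'rV[int]_n.+1) : toN a = 0 <-> exists c : int, a = const_mx c.
Proof.
split=> [h|[c ->]]; last by apply/rowP=> i; rewrite !mxE subrr.
exists (a ord0 ord0); apply/rowP=> -[j hj]; rewrite mxE.
elim: j hj => [|j IH] hj; first by congr (a _ _); apply: val_inj.
have hj' : (j < n)%N by [].
move/rowP/(_ (Ordinal hj')): h; rewrite !mxE => /eqP; rewrite subr_eq0 => /eqP h.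
rewrite -(IH (ltnW hj)) -[RHS](_ : a ord0 (widen_ord (leqnSn n) (Ordinal hj')) = _).
  by rewrite h; congr (a _ _); apply: val_inj.
by congr (a _ _); apply: val_inj.
Qed.

Lemma toN_surj (u : 'rV[int]_n) : exists a, toN a = u.
Proof.
exists (\row_(i < n.+1) \sum_(j < n | (i <= j)%N) u ord0 j).
apply/rowP=> i; rewrite !mxE /= (bigD1 i) //= [X in _ - X](eq_bigl
  (fun j : 'I_n => (i <= j)%N && (j != i))) ?addrK // => j.
by rewrite /bump leq0n add1n ltn_neqAle andbC eq_sym.
Qed.

Definition varpi (i : nat) : 'rV[int]_n :=
  toN (\sum_(k < n.+1 | (k < i)%N) delta_mx ord0 k).

Variable T : {set edge n}.

(* k : 'I_n stands for the index k+1 of [n].                                 *)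
Definition vertex (k : 'I_n) : 'I_n.+2 := inord k.+1.

Definition vvec (k : 'I_n) : 'rV[int]_n :=
  varpi (vertex k) - varpi (rightv T (vertex k)).

Definition wvec (k : 'I_n) : 'rV[int]_n :=
  varpi (leftv T (vertex k)) - varpi (vertex k).

End Lattice.

(** * Cones and fans in N (x) R *)

Section Fan.
Variables (R : realType) (n : nat).

Definition cone (Q : set 'rV[int]_n) : set 'rV[R]_n :=
  [set u | exists (r : nat) (q : 'I_r -> 'rV[int]_n) (a : 'I_r -> R),
     [/\ forall i, Q (q i), forall i, 0 <= a i
       & u = \sum_i a i *: map_mx intr (q i)]].

Definition fanT (T : {set edge n}) : set (set 'rV[R]_n) :=
  [set sigma | exists Q : set 'rV[int]_n,
     [/\ forall u, Q u -> exists k, u = vvec T k \/ u = wvec T k,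
         forall k, ~ (Q (vvec T k) /\ Q (wvec T k))
       & sigma = cone Q]].

End Fan.

Arguments cone R {n} Q.
Arguments fanT R {n} T.

(** * Varieties over a field, as spaces with functions

  A variety is given by its closed points, its Zariski open sets and, on every
  open set, its regular functions (of which only the values on that open set
  matter). *)

Section Spaces.
Variable K : fieldType.

Record fspace := FSpace {
  pts :> Type;
  isopen : set pts -> Prop;
  isregular : set pts -> (pts -> K) -> Prop }.

(* An isomorphism onto a closed subspace with the induced structure.         *)
Definition closed_embedding (X Y : fspace) (phi : X -> Y) : Prop :=
  [/\ injective phi, isopen (~` range phi),
      forall V : set Y, isopen V -> isopen (phi @^-1` V) /\
        forall f, isregular V f -> isregular (phi @^-1` V) (f \o phi),
      forall U : set X, isopen U ->
        exists2 V : set Y, isopen V & phi @^-1` V = U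
    & forall (U : set X) f, isopen U -> isregular U f ->
        forall x, U x -> exists (V : set Y) g,
          [/\ isopen V, V (phi x), phi @^-1` V `<=` U, isregular V g
            & forall y, V (phi y) -> g (phi y) = f y]].

Section Projective.
Variable r : nat.

Definition line := {V : {vspace 'rV[K]_r.+1} | \dim V == 1%N}.

Definition evalp (p : {mpoly K[r.+1]}) (w : 'rV[K]_r.+1) : K :=
  p.@[fun i => w ord0 i].

Definition proj_open (U : set line) : Prop :=
  exists2 S : set {mpoly K[r.+1]},
    forall p, S p -> exists d, p \is d.-homog
  & forall W : line,
      U W <-> exists p w, [/\ S p, w \in sval W & evalp p w != 0].

Definition proj_regular (U : set line) (f : line -> K) : Prop :=
  forall W : line, U W -> exists (d : nat) (p q : {mpoly K[r.+1]}),
    [/\ p \is d.-homog, q \is d.-homog,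
        exists2 w, w \in sval W & evalp q w != 0
      & forall (W' : line) w, U W' -> w \in sval W' -> w != 0 ->
          evalp q w != 0 -> f W' = evalp p w / evalp q w].

Definition projective_space : fspace := FSpace proj_open proj_regular.

End Projective.
End Spaces.

(** * The toric variety X(Sigma) over C = R[i]

  X(Sigma) is glued from the affine charts U_sigma = Spec C[S_sigma], where
  S_sigma is the intersection of the dual cone of sigma with the dual lattice
  M = Z^n.  The closed points of U_sigma are the monoid homomorphisms from
  S_sigma to the multiplicative monoid C, and U_sigma, U_sigma' are glued along
  U_(sigma `&` sigma'). *)

Section Toric.
Variables (R : realType) (n : nat).
Local Notation C := (R[i]).
Local Notation M := ('rV[int]_n).
Local Notation rcone := (set 'rV[R]_n).

Definition dual_monoid (sigma : rcone) : set M :=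
  [set m | forall u, sigma u -> 0 <= \sum_i (m ord0 i)%:~R * u ord0 i].

(* Homomorphisms are extended by 0, so that equal homomorphisms are equal    *)
(* as functions on M.                                                        *)
Definition monoid_hom (sigma : rcone) (g : M -> C) : Prop :=
  [/\ g 0 = 1,
      forall m m', dual_monoid sigma m -> dual_monoid sigma m' ->
        g (m + m') = g m * g m'
    & forall m, ~ dual_monoid sigma m -> g m = 0].

(* Elements of C[S_sigma], as functions on U_sigma.                          *)
Definition coord_ring (sigma : rcone) (h : (M -> C) -> C) : Prop :=
  exists (r : nat) (c : 'I_r -> C) (m : 'I_r -> M),
    (forall i, dual_monoid sigma (m i)) /\
    forall g, h g = \sum_i c i * g (m i).

Variable Sigma : set rcone.

Definition chart_point : Type := (rcone * (M -> C))%type.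

Definition is_chart_point (p : chart_point) : Prop :=
  Sigma p.1 /\ monoid_hom p.1 p.2.

Definition glued (p q : chart_point) : Prop :=
  exists2 d, monoid_hom (p.1 `&` q.1) d
  & (forall m, dual_monoid p.1 m -> d m = p.2 m) /\
    (forall m, dual_monoid q.1 m -> d m = q.2 m).

Definition toric_point : Type :=
  {A : set chart_point | exists2 p, is_chart_point p
     & A = [set q | is_chart_point q /\ glued p q]}.

(* x lies in the chart U_sigma and corresponds there to g.                   *)
Definition in_chart (x : toric_point) (sigma : rcone) (g : M -> C) : Prop :=
  sval x (sigma, g).

Definition toric_open (U : set toric_point) : Prop :=
  forall x sigma g, U x -> in_chart x sigma g ->
  exists h, [/\ coord_ring sigma h, h g != 0
    & forall y g', in_chart y sigma g' -> h g' != 0 -> U y].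

Definition toric_regular (U : set toric_point) (f : toric_point -> C) : Prop :=
  forall x sigma g, U x -> in_chart x sigma g ->
  exists a h, [/\ coord_ring sigma a, coord_ring sigma h, h g != 0
    & forall y g', in_chart y sigma g' -> U y -> h g' != 0 ->
        f y = a g' / h g'].

Definition toric_variety : fspace C := FSpace toric_open toric_regular.

(** ** The anticanonical line bundle

  The rows u_j of A form a basis of N and sigma is generated by some of them.
  The dual basis (m_i) of M gives the coordinates x_i = chi^(m_i) on U_sigma,
  which identify it with a product of d copies of C and n - d copies of the
  multiplicative group of C, d being the dimension of sigma. *)

Definition coordinates (sigma : rcone) (A : 'M[int]_n) : Prop :=
  A \in unitmx /\
  exists I : {set 'I_n}, sigma = cone R [set u | exists2 j, j \in I & u = row j A].

Definition smooth_fan : Prop :=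
  forall sigma, Sigma sigma -> exists A, coordinates sigma A.

Definition dual_basis (A : 'M[int]_n) : 'M[int]_n := (invmx A)^T.

(* The Jacobian matrix (dx'_i / dx_j): as x'_i is the product of the x_j^a_ij *)
(* with a_ij = <m'_i, u_j>, its derivative with respect to x_j is            *)
(* a_ij chi^(m'_i - m_j).                                                    *)
Definition jacobian (A A' : 'M[int]_n) (d : M -> C) : 'M[C]_n :=
  \matrix_(i, j) ((\sum_l dual_basis A' i l * A j l)%:~R *
                  d (row i (dual_basis A') - row j (dual_basis A))).

(* Global sections of the k-th tensor power of the anticanonical bundle:     *)
(* s sigma A is the coefficient of                                           *)
(*   (d/dx_1 /\ ... /\ d/dx_n)^(tensor k)                                    *)
(* in the coordinates of A on U_sigma.                                       *)
Definition presection : Type := rcone -> 'M[int]_n -> (M -> C) -> C.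

Definition anticanonical_section (k : nat) (s : presection) : Prop :=
  (forall sigma A, Sigma sigma -> coordinates sigma A ->
     coord_ring sigma (s sigma A)) /\
  (forall sigma A sigma' A',
     Sigma sigma -> coordinates sigma A ->
     Sigma sigma' -> coordinates sigma' A' ->
     forall d, monoid_hom (sigma `&` sigma') d ->
       s sigma' A' d = \det (jacobian A A' d) ^+ k * s sigma A d).

(* The values of the sections at any point span a line (in particular they   *)
(* have no common zero) and the resulting map to projective space is a       *)
(* closed embedding.                                                         *)
Definition anticanonical_power_very_ample (k : nat) : Prop :=
  exists (r : nat) (s : 'I_r.+1 -> presection)
         (phi : toric_variety -> projective_space C r),
  [/\ forall i, anticanonical_section k (s i),
      forall x sigma g A, in_chart x sigma g -> coordinates sigma A ->
        sval (phi x) = <[\row_i s i sigma A g]>%VS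
    & closed_embedding phi].

Definition anticanonical_ample : Prop :=
  exists2 k : nat, (0 < k)%N & anticanonical_power_very_ample k.

(* Smoothness provides every chart with coordinates, without which           *)
(* anticanonical_ample would not be meaningful.                              *)
Definition is_Fano : Prop := smooth_fan /\ anticanonical_ample.

End Toric.

(* Main.v *)
(* The fan of T is that of a tower of P^1-bundles: the base {k_L, k_R} of the *)
(* triangle at k is either e or a leg of exactly one triangle, at some j, so  *)
(* v_k + w_k is 0 or one of v_j, w_j.  Hence every choice of one of v_k, w_k  *)
(* for each k is a basis of N, the point vert of M with value -1 on the       *)
(* chosen vectors is >= 0 on the others, and vert + m_i (m_i the dual basis)  *)
(* is >= -1 on all rays.  So already the first power of the anticanonical     *)
(* bundle, with the lattice points of the polytope P = {m : m >= -1 on every  *)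
(* ray} as sections, is very ample: where the section of vert does not vanish *)
(* (the corresponding maximal chart) the sections of vert + m_i restrict to   *)
(* the coordinates.  The image is the zero set of all homogeneous binomials   *)
(* vanishing on it: this uses that a lattice point of P other than these      *)
(* vertices is the midpoint of two other lattice points of P.                 *)

Require Import Defs.
From HB Require Import structures.
From mathcomp Require Import all_boot all_order all_algebra.
From mathcomp Require Import boolp classical_sets reals.
From mathcomp Require Import complex mpoly.
From mathcomp Require Import perm zify.

Set Implicit Arguments.
Unset Strict Implicit.
Unset Printing Implicit Defensive.

Import Order.TTheory GRing.Theory Num.Theory.

Local Open Scope classical_set_scope.
Local Open Scope ring_scope.

(** * Cones generated by part of a lattice basis *)

(** The proof has three layers. Combinatorics: an edge count shows that every k is the middle vertex
    of a triangle of the recursion ([triangle_exists]). The sum v_k + w_k is varpi at k_L minus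
    varpi at k_R, so it depends only on the base of that triangle, and it is 0 or a ray belonging to
    a wider triangle ([ray_tower]). Lattice geometry of such towers: by induction on the rank, every
    choice of one ray per index is a basis of N ([selection_unit]). The point pairing to -1 with the
    chosen rays pairs to at least 0 with the others ([vertex_of_flip]), because each of these is a
    lower generator or 0, minus a chosen ray. This is strict convexity of the support function of
    the anticanonical divisor, hence ampleness. Algebraic geometry, in a form that makes very
    ampleness explicit: convexity makes cones meet along their common rays ([max_face]), so lattice
    points of the polytope give global sections ([section_transition]). Sections at a vertex and at
    its neighbours recover the chart coordinates, so proportional section values mean the same point
    ([coord_row_glued]). A line satisfying the binomial relations has a nonzero vertex coordinate
    ([binomial_vert], resting on [tower_extremal]) and then comes from a point ([binomial_chart]),
    so the image is closed. *)

Section Pairing.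
Variable n : nat.
Local Notation M := 'rV[int]_n.

Definition dot (m u : M) : int := \sum_l m ord0 l * u ord0 l.

Lemma dotDl m m' u : dot (m + m') u = dot m u + dot m' u.
Proof. by rewrite -big_split; apply: eq_bigr => l _; rewrite mxE mulrDl. Qed.

Lemma dotZl a m u : dot (a *: m) u = a * dot m u.
Proof. by rewrite mulr_sumr; apply: eq_bigr => l _; rewrite mxE mulrA. Qed.

Lemma dotNl m u : dot (- m) u = - dot m u.
Proof. by rewrite -scaleN1r dotZl mulN1r. Qed.

Lemma dotBl m m' u : dot (m - m') u = dot m u - dot m' u.
Proof. by rewrite dotDl dotNl. Qed.

Lemma dot0l u : dot 0 u = 0.
Proof. by rewrite -(scale0r 0) dotZl mul0r. Qed.

Lemma dot_suml (I : Type) (r : seq I) (P : pred I) (f : I -> M) u :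
  dot (\sum_(i <- r | P i) f i) u = \sum_(i <- r | P i) dot (f i) u.
Proof. by apply: (big_morph (dot^~ u)) => [m m'|]; rewrite ?dotDl ?dot0l. Qed.

Lemma dotC m u : dot m u = dot u m.
Proof. by apply: eq_bigr => l _; rewrite mulrC. Qed.

Lemma dotDr m u u' : dot m (u + u') = dot m u + dot m u'.
Proof. by rewrite !(dotC m) dotDl. Qed.

Lemma dot0r m : dot m 0 = 0.
Proof. by rewrite dotC dot0l. Qed.

Lemma dot_sumr (I : Type) (r : seq I) (P : pred I) (f : I -> M) m :
  dot m (\sum_(i <- r | P i) f i) = \sum_(i <- r | P i) dot m (f i).
Proof. by rewrite dotC dot_suml; apply: eq_bigr => i _; rewrite dotC. Qed.

Lemma dotZr a m u : dot m (a *: u) = a * dot m u.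
Proof. by rewrite dotC dotZl dotC. Qed.

Lemma dot_self_gt0 m : m != 0 -> 0 < dot m m.
Proof.
move=> m0; have [l ml] : exists l, m ord0 l != 0.
  apply/existsP; apply: contraNT m0; rewrite negb_exists => /forallP m0.
  by apply/eqP/rowP => l; rewrite mxE; apply/eqP/negPn.
rewrite /dot (bigD1 l) //= ltr_wpDr ?sumr_ge0 // => [i _|].
  by rewrite -expr2 sqr_ge0.
by rewrite -expr2 exprn_even_gt0.
Qed.

Variable A : 'M[int]_n.
Hypothesis uA : A \in unitmx.

Lemma dot_dual_basis i j : dot (row i (dual_basis A)) (row j A) = (i == j)%:R.
Proof.
have := congr1 (fun B : 'M_n => B j i) (mulmxV uA); rewrite !mxE eq_sym => <-.
by apply: eq_bigr => l _; rewrite !mxE mulrC.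
Qed.

Lemma dual_basis_expand m :
  m = \sum_i dot m (row i A) *: row i (dual_basis A).
Proof.
have e : A^T *m dual_basis A = 1%:M by rewrite -trmx_mul mulVmx // trmx1.
rewrite -{1}[m]mulmx1 -e mulmxA mulmx_sum_row; apply: eq_bigr => i _.
by congr (_ *: _); rewrite !mxE; apply: eq_bigr => l _; rewrite !mxE.
Qed.

Lemma row_expand u :
  u = \sum_j dot (row j (dual_basis A)) u *: row j A.
Proof.
rewrite -{1}[u]mulmx1 -(mulVmx uA) mulmxA mulmx_sum_row; apply: eq_bigr => j _.
by congr (_ *: _); rewrite !mxE; apply: eq_bigr => l _; rewrite !mxE mulrC.
Qed.

Lemma dot_inj m m' :
  (forall i, dot m (row i A) = dot m' (row i A)) -> m = m'.
Proof.
move=> e; rewrite [m]dual_basis_expand [m']dual_basis_expand.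
by apply: eq_bigr => i _; rewrite e.
Qed.

Lemma row_neq0 j : row j A != 0.
Proof.
by apply/eqP => e; have := dot_dual_basis j j; rewrite e dot0r eqxx.
Qed.

End Pairing.

Section Cones.
Variables (R : realType) (n : nat).
Local Notation M := 'rV[int]_n.
Local Notation V := 'rV[R]_n.

Definition rdot (m : M) (u : V) : R := \sum_l (m ord0 l)%:~R * u ord0 l.

Lemma rdot_int m q : rdot m (map_mx intr q) = (dot m q)%:~R.
Proof. by rewrite /dot rmorph_sum; apply: eq_bigr => l _; rewrite mxE rmorphM. Qed.

Lemma rdotDl m m' u : rdot (m + m') u = rdot m u + rdot m' u.
Proof.
by rewrite -big_split; apply: eq_bigr => l _; rewrite mxE rmorphD mulrDl.
Qed.

Lemma rdot0l u : rdot 0 u = 0.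
Proof. by apply: big1 => l _; rewrite mxE mul0r. Qed.

Lemma rdot_sumr (I : Type) (r : seq I) (P : pred I) (a : I -> R) (f : I -> V) m :
  rdot m (\sum_(i <- r | P i) a i *: f i) =
  \sum_(i <- r | P i) a i * rdot m (f i).
Proof.
apply: (big_ind2 (fun u x => rdot m u = x)).
- by apply: big1 => l _; rewrite mxE mulr0.
- move=> u x v y <- <-; rewrite -big_split; apply: eq_bigr => l _.
  by rewrite mxE mulrDr.
- by move=> i _; rewrite mulr_sumr; apply: eq_bigr => l _; rewrite mxE mulrCA.
Qed.

Lemma dual_cone (Q : set M) m :
  dual_monoid (cone R Q) m <-> forall q, Q q -> 0 <= dot m q.
Proof.
split=> [h q Qq|h u [r [q [a [Qq a0 ->]]]]].
  rewrite -(ler0z R) -rdot_int; apply: h; exists 1, (fun=> q), (fun=> 1).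
  by split=> //; rewrite big_ord1 scale1r.
rewrite -/(rdot m _) rdot_sumr sumr_ge0 // => i _.
by rewrite mulr_ge0 // rdot_int ler0z h.
Qed.

Lemma cone_gen (Q : set M) q : Q q -> cone R Q (map_mx intr q).
Proof.
move=> Qq; exists 1, (fun=> q), (fun=> 1).
by split=> //; rewrite big_ord1 scale1r.
Qed.

Lemma cone_sum (k : nat) (Q : set M) (a : 'I_k -> R) (q : 'I_k -> M) :
  (forall i, 0 <= a i) -> (forall i, a i != 0 -> Q (q i)) ->
  cone R Q (\sum_i a i *: map_mx intr (q i)).
Proof.
move=> a0 aQ.
have -> : \sum_i a i *: map_mx intr (q i) =
   \sum_(i in [pred i | a i != 0]) a i *: map_mx intr (q i) :> V.
  rewrite [RHS]big_mkcond; apply: eq_bigr => i _; case: ifPn => //.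
  by rewrite inE negbK => /eqP ->; rewrite scale0r.
rewrite big_enum_val; exists #|[pred i | a i != 0]|, (fun i => q (enum_val i)),
  (fun i => a (enum_val i)); split=> // i.
by apply: aQ; have := enum_valP i.
Qed.

Definition rays (A : 'M[int]_n) (I : {set 'I_n}) : set M :=
  [set u | exists2 j, j \in I & u = row j A].

Lemma raysP A (I : {set 'I_n}) j : j \in I -> rays A I (row j A).
Proof. by move=> jI; exists j. Qed.

Section Basis.
Variables (A : 'M[int]_n) (uA : A \in unitmx).

Lemma rdot_expand (u : V) :
  u = \sum_j rdot (row j (dual_basis A)) u *: map_mx intr (row j A).
Proof.
have e : map_mx (intr : int -> R) (invmx A) *m map_mx intr A = 1%:M.
  by rewrite -map_mxM mulVmx // map_mx1.
rewrite -{1}[u]mulmx1 -e mulmxA mulmx_sum_row; apply: eq_bigr => j _.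
rewrite map_row; congr (_ *: _); rewrite !mxE.
by apply: eq_bigr => l _; rewrite !mxE mulrC.
Qed.

Lemma rdot_expandE m (u : V) : rdot m u =
  \sum_j rdot (row j (dual_basis A)) u * (dot m (row j A))%:~R.
Proof.
rewrite {1}[u]rdot_expand rdot_sumr.
by apply: eq_bigr => j _; rewrite rdot_int.
Qed.

Lemma rays_cone I u : cone R (rays A I) u <->
  forall j, 0 <= rdot (row j (dual_basis A)) u /\
            (j \notin I -> rdot (row j (dual_basis A)) u = 0).
Proof.
split=> [[r [q [a [Qq a0 ->]]]] j|h].
  rewrite rdot_sumr; split=> [|jI].
    rewrite sumr_ge0 // => i _; rewrite mulr_ge0 // rdot_int ler0z.
    by case: (Qq i) => l _ ->; rewrite dot_dual_basis.
  rewrite big1 // => i _; rewrite rdot_int; case: (Qq i) => l lI ->.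
  rewrite dot_dual_basis //; case: eqP => [jl|_]; last by rewrite mulr0.
  by rewrite jl lI in jI.
rewrite [u]rdot_expand; apply: cone_sum => [j|j aj]; first exact: (h j).1.
by apply: raysP; apply: contraNT aj => /(h j).2 ->.
Qed.

Lemma dual_rays I m : dual_monoid (cone R (rays A I)) m <->
  forall j, j \in I -> 0 <= dot m (row j A).
Proof.
rewrite dual_cone; split=> [h j jI|h q [j jI ->]]; last exact: h.
exact/h/raysP.
Qed.

End Basis.

(* The sum of the coordinates takes positive integral values on nonzero      *)
(* lattice points of a cone, so a lattice point of value 1 is irreducible.   *)
Lemma sub_rays A A' I I' : A \in unitmx -> A' \in unitmx ->
  cone R (rays A I) = cone R (rays A' I') -> rays A I `<=` rays A' I'.
Proof.
move=> uA uA' e u [j jI ->].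
pose phi q := \sum_i dot (row i (dual_basis A)) q.
pose c k := dot (row k (dual_basis A')) (row j A).
have c0 k : 0 <= c k /\ (k \notin I' -> c k = 0).
  have /(rays_cone uA') /(_ k) : cone R (rays A' I') (map_mx intr (row j A)).
    by rewrite -e; apply: cone_gen; exact: raysP.
  rewrite rdot_int ler0z => -[? h]; split=> // /h /eqP.
  by rewrite intr_eq0 => /eqP.
have phi1 k : k \in I' -> 1 <= phi (row k A').
  move=> kI; have d0 i : 0 <= dot (row i (dual_basis A)) (row k A').
    have /(rays_cone uA) /(_ i) [] : cone R (rays A I) (map_mx intr (row k A')).
      by rewrite e; apply: cone_gen; exact: raysP.
    by rewrite rdot_int ler0z.
  rewrite -gtz0_ge1 lt0r sumr_ge0 // andbT; apply: contraNneq (row_neq0 uA' k).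
  move=> /eqP; rewrite psumr_eq0 // => /allP z.
  rewrite (row_expand uA (row k A')) big1 // => i _.
  by have /eqP -> := z i (mem_index_enum i); rewrite scale0r.
have : phi (row j A) = 1.
  rewrite /phi (bigD1 j) //= dot_dual_basis // eqxx big1 ?addr0 // => i ij.
  by rewrite dot_dual_basis // (negPf ij).
have -> : phi (row j A) = \sum_k c k * phi (row k A').
  rewrite [LHS](congr1 phi (row_expand uA' (row j A))) /phi.
  under eq_bigr do rewrite dot_sumr.
  rewrite exchange_big; apply: eq_bigr => k _; rewrite mulr_sumr.
  by apply: eq_bigr => i _; rewrite dotZr.
have cge k : c k <= c k * phi (row k A').
  have [kI|kI] := boolP (k \in I'); last by rewrite (c0 k).2 // mul0r.
  by rewrite ler_peMr ?phi1 // (c0 k).1.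
move=> s1; have [k ck] : exists k, c k != 0.
  apply/existsP; apply: contra_eqT s1; rewrite negb_exists => /forallP z.
  by rewrite big1 // => k _; have /negPn/eqP -> := z k; rewrite mul0r.
have kI : k \in I' by apply: contraNT ck => /(c0 k).2 ->.
have c1 : 1 <= c k by rewrite -gtz0_ge1 lt0r ck (c0 k).1.
have le1 : \sum_i c i <= 1 by rewrite -s1 ler_sum.
have ge0 : 0 <= \sum_(i | i != k) c i by apply: sumr_ge0 => i _; exact: (c0 i).1.
have z : \sum_(i | i != k) c i = 0.
  apply/eqP; rewrite eq_le ge0 andbT -(lerD2l (c k)) addr0 (le_trans _ c1) //.
  by move: le1; rewrite (bigD1 k).
have ck1 : c k = 1.
  by apply/eqP; rewrite eq_le c1 andbT; move: le1; rewrite (bigD1 k) //= z addr0.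
exists k => //; rewrite (row_expand uA' (row j A)) (bigD1 k) //= -/(c k) ck1 scale1r.
rewrite big1 ?addr0 // => i ik.
move/eqP: z; rewrite psumr_eq0 => [/allP z|l _]; last exact: (c0 l).1.
have := z i (mem_index_enum i); rewrite ik => /eqP; rewrite -/(c i) => ->.
by rewrite scale0r.
Qed.

End Cones.

(** * Points of affine charts *)

Section Homs.
Variables (R : realType) (n : nat).
Local Notation C := (R[i]).
Local Notation M := ('rV[int]_n).
Implicit Types (sigma tau : set 'rV[R]_n) (g : M -> C) (m : M).

Lemma dual_monoidD sigma m m' : dual_monoid sigma m -> dual_monoid sigma m' ->
  dual_monoid sigma (m + m').
Proof.
by move=> h h' u su; rewrite -/(rdot _ _) rdotDl addr_ge0 //; [exact: h|exact: h'].
Qed.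

Lemma dual_monoid0 sigma : dual_monoid sigma 0.
Proof. by move=> u _; rewrite -/(rdot _ _) rdot0l. Qed.

Lemma dual_monoid_sum sigma (I : Type) (r : seq I) (P : pred I) (f : I -> M) :
  (forall i, P i -> dual_monoid sigma (f i)) ->
  dual_monoid sigma (\sum_(i <- r | P i) f i).
Proof.
move=> h; apply: (big_ind (dual_monoid sigma)) => //; first exact: dual_monoid0.
by move=> m m'; exact: dual_monoidD.
Qed.

Lemma dual_monoidMn sigma m k : dual_monoid sigma m -> dual_monoid sigma (m *+ k).
Proof.
move=> h; elim: k => [|k IH]; rewrite ?mulrS; first exact: dual_monoid0.
exact: dual_monoidD.
Qed.

Lemma dual_monoidS sigma tau : sigma `<=` tau ->
  dual_monoid tau `<=` dual_monoid sigma.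
Proof. by move=> st m h u /st; exact: h. Qed.

Lemma hom_sum sigma g (I : Type) (r : seq I) (P : pred I) (f : I -> M) :
  monoid_hom sigma g -> (forall i, P i -> dual_monoid sigma (f i)) ->
  g (\sum_(i <- r | P i) f i) = \prod_(i <- r | P i) g (f i).
Proof.
move=> [g0 gD _] h.
suff [] : dual_monoid sigma (\sum_(i <- r | P i) f i) /\
  g (\sum_(i <- r | P i) f i) = \prod_(i <- r | P i) g (f i) by [].
apply: (big_ind2 (fun m x => dual_monoid sigma m /\ g m = x)).
- by split=> //; exact: dual_monoid0.
- move=> m x m' y [dm <-] [dm' <-]; split; first exact: dual_monoidD.
  exact: gD.
- by move=> i /h.
Qed.

Lemma hom_mulrn sigma g m k : monoid_hom sigma g -> dual_monoid sigma m ->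
  g (m *+ k) = g m ^+ k.
Proof.
move=> hg dm; have := hom_sum (index_enum 'I_k) (P := xpredT) (f := fun=> m) hg.
by rewrite sumr_const prodr_const card_ord => ->.
Qed.

Lemma hom_opp sigma g m : monoid_hom sigma g -> dual_monoid sigma m ->
  dual_monoid sigma (- m) -> g (- m) = (g m)^-1 /\ g m != 0.
Proof.
move=> [g0 gD _] dm dN; have := gD _ _ dm dN; rewrite subrr g0 => e.
have gm : g m != 0.
  by apply/eqP => z; move/eqP: e; rewrite z mul0r oner_eq0.
by split=> //; apply: (mulfI gm); rewrite -e divff.
Qed.

Lemma hom_scale sigma g m z : monoid_hom sigma g -> dual_monoid sigma m ->
  0 <= z \/ dual_monoid sigma (- m) ->
  dual_monoid sigma (z *: m) /\ g (z *: m) = g m ^ z.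
Proof.
move=> hg dm; case: z => k h.
  have -> : Posz k *: m = m *+ k by rewrite -[Posz k]natz scaler_nat.
  by split; [exact: dual_monoidMn|exact: hom_mulrn hg dm].
case: h => // dN; have -> : Negz k *: m = (- m) *+ k.+1.
  by rewrite NegzE scaleNr -[Posz k.+1]natz scaler_nat mulNrn.
split; first exact: dual_monoidMn.
by rewrite (hom_mulrn _ hg dN) (hom_opp hg dm dN).1 exprVn.
Qed.

(** Each factor makes sense because its exponent is nonnegative or the coordinate is a unit on the
    chart. *)
Lemma hom_expand sigma g A m : A \in unitmx -> monoid_hom sigma g ->
  (forall i, dual_monoid sigma (row i (dual_basis A))) ->
  (forall i, 0 <= dot m (row i A) \/
             dual_monoid sigma (- row i (dual_basis A))) ->
  g m = \prod_i g (row i (dual_basis A)) ^ dot m (row i A).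
Proof.
move=> uA hg dA h; rewrite {1}(dual_basis_expand uA m) (hom_sum _ hg) => [|i _].
  by apply: eq_bigr => i _; rewrite (hom_scale hg (dA i) (h i)).2.
exact: (hom_scale hg (dA i) (h i)).1.
Qed.

Lemma eq_hom sigma tau g d A : A \in unitmx ->
  monoid_hom sigma g -> monoid_hom tau d -> tau `<=` sigma ->
  (forall i, dual_monoid sigma (row i (dual_basis A))) ->
  (forall i, g (row i (dual_basis A)) = d (row i (dual_basis A))) ->
  forall m, (forall i, 0 <= dot m (row i A) \/
             dual_monoid sigma (- row i (dual_basis A))) -> g m = d m.
Proof.
move=> uA hg hd ts dA e m h; rewrite (hom_expand uA hg) // (hom_expand uA hd).
- by apply: eq_bigr => i _; rewrite e.
- by move=> i; exact: dual_monoidS ts _ (dA i).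
- by move=> i; case: (h i) => ?; [left|right; exact: dual_monoidS ts _ _].
Qed.

Section Chart.
Variables (A : 'M[int]_n) (I : {set 'I_n}).
Hypothesis uA : A \in unitmx.
Local Notation sigma := (cone R (rays A I)).

Lemma dual_row i : dual_monoid sigma (row i (dual_basis A)).
Proof. by apply/dual_rays => j _; rewrite dot_dual_basis. Qed.

Lemma dual_rowN i : i \notin I -> dual_monoid sigma (- row i (dual_basis A)).
Proof.
move=> iI; apply/dual_rays => j jI; rewrite dotNl dot_dual_basis //.
by case: eqP jI iI => // -> ->.
Qed.

Lemma dual_row_or m : dual_monoid sigma m -> forall i,
  0 <= dot m (row i A) \/ dual_monoid sigma (- row i (dual_basis A)).
Proof.
move=> /dual_rays dm i; have [iI|/dual_rowN] := boolP (i \in I); last by right.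
by left; exact: dm.
Qed.

Lemma chart_expand g m : monoid_hom sigma g -> dual_monoid sigma m ->
  g m = \prod_i g (row i (dual_basis A)) ^ dot m (row i A).
Proof.
move=> hg dm; apply: (hom_expand uA hg dual_row); exact: dual_row_or.
Qed.

Lemma chart_neq0 g i : monoid_hom sigma g -> i \notin I ->
  g (row i (dual_basis A)) != 0.
Proof. by move=> hg iI; case: (hom_opp hg (dual_row i) (dual_rowN iI)). Qed.

End Chart.

Definition monomial (A : 'M[int]_n) (x : 'I_n -> C) m : C :=
  \prod_i x i ^ dot m (row i A).

(** The convention 0^-1 = 0 breaks additivity of exponents at a vanishing coordinate, so negative
    exponents are excluded there. *)
Lemma monomialD A x m m' :
  (forall i, x i = 0 -> 0 <= dot m (row i A) /\ 0 <= dot m' (row i A)) ->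
  monomial A x (m + m') = monomial A x m * monomial A x m'.
Proof.
move=> h; rewrite -big_split; apply: eq_bigr => i _ /=; rewrite dotDl.
have [/h[]|x0] := eqVneq (x i) 0; last by rewrite expfzDr.
by case: (dot m _) => // a _; case: (dot m' _) => // b _; rewrite exprzD_nat.
Qed.

Definition point_of sigma (A : 'M[int]_n) (x : 'I_n -> C) m : C :=
  if `[< dual_monoid sigma m >] then monomial A x m else 0.

Lemma point_ofE sigma A x m : dual_monoid sigma m ->
  point_of sigma A x m = monomial A x m.
Proof. by move=> dm; rewrite /point_of asboolT. Qed.

Lemma monomial_dual_row A x i : A \in unitmx ->
  monomial A x (row i (dual_basis A)) = x i.
Proof.
move=> uA; rewrite /monomial (bigD1 i) //= dot_dual_basis // eqxx.
rewrite big1 ?mulr1 // => j ji.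
by rewrite dot_dual_basis // eq_sym (negPf ji).
Qed.

Lemma point_of_hom sigma A x :
  (forall i, x i = 0 -> sigma (map_mx intr (row i A))) ->
  monoid_hom sigma (point_of sigma A x).
Proof.
move=> h; have d0 m i : dual_monoid sigma m -> x i = 0 -> 0 <= dot m (row i A).
  by move=> dm /h /dm; rewrite -/(rdot _ _) rdot_int ler0z.
split=> [|m m' dm dm'|m dm].
- rewrite point_ofE; last exact: dual_monoid0.
  by apply: big1 => i _; rewrite dot0l.
- rewrite !point_ofE //; last exact: dual_monoidD.
  by apply: monomialD => i xi; split; exact: d0.
- by rewrite /point_of asboolF.
Qed.

End Homs.

(** * Homogeneous polynomials *)

Section Monomials.
Variables (K : fieldType) (r : nat).
Implicit Types (w : 'rV[K]_r.+1) (a b : 'X_{1..r.+1}).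

Definition mpow w a : K := \prod_i w ord0 i ^+ a i.

Lemma mpowD w a b : mpow w (a + b)%MM = mpow w a * mpow w b.
Proof. by rewrite -big_split; apply: eq_bigr => i _; rewrite mnmDE exprD. Qed.

Lemma mpow0 w : mpow w 0%MM = 1.
Proof. by apply: big1 => i _; rewrite mnm0E. Qed.

Lemma mpowU w i : mpow w U_(i)%MM = w ord0 i.
Proof.
rewrite /mpow (bigD1 i) //= mnm1E eqxx expr1 big1 ?mulr1 // => j ji.
by rewrite mnm1E eq_sym (negPf ji).
Qed.

Lemma mpowMn w a k : mpow w (a *+ k)%MM = mpow w a ^+ k.
Proof.
by rewrite -prodrXl; apply: eq_bigr => i _; rewrite mulmnE exprM.
Qed.

Lemma mpow_sum w (I : Type) (s : seq I) (F : I -> 'X_{1..r.+1}) :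
  mpow w (\sum_(i <- s) F i)%MM = \prod_(i <- s) mpow w (F i).
Proof. by apply: (big_morph (mpow w)) => [a b|]; rewrite ?mpowD ?mpow0. Qed.

Lemma mpowZ c w a : mpow (c *: w) a = c ^+ mdeg a * mpow w a.
Proof.
rewrite mdegE expr_sum -big_split; apply: eq_bigr => i _.
by rewrite mxE exprMn.
Qed.

Lemma evalpX w a : evalp 'X_[a] w = mpow w a.
Proof. exact: mevalX. Qed.

Lemma evalpE w (p : {mpoly K[r.+1]}) :
  evalp p w = \sum_(a <- msupp p) p@_a * mpow w a.
Proof. exact: mevalE. Qed.

Lemma evalp_homog c w (p : {mpoly K[r.+1]}) d : p \is d.-homog ->
  evalp p (c *: w) = c ^+ d * evalp p w.
Proof.
move=> /dhomogP hp; rewrite !evalpE mulr_sumr; apply: eq_big_seq => a /hp da.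
by rewrite mpowZ -da mulrCA.
Qed.

Lemma evalp_neq0 w (p : {mpoly K[r.+1]}) d : p \is d.+1.-homog ->
  evalp p w != 0 -> w != 0.
Proof.
move=> hp; apply: contraNneq => ->.
by rewrite -(scale0r 0) (evalp_homog _ _ hp) expr0n mul0r.
Qed.

Lemma vlineZ (c : K) w : c != 0 -> <[c *: w]>%VS = <[w]>%VS.
Proof.
move=> c0; apply/vspaceP => v; apply/vlineP/vlineP => -[a ->].
  by exists (a * c); rewrite scalerA.
by exists (a / c); rewrite scalerA divfK.
Qed.

Lemma lineP (W : line K r) w : w \in sval W -> w != 0 -> sval W = <[w]>%VS.
Proof.
move=> wW w0; apply/esym/eqP; rewrite eqEdim dim_vline w0 (eqP (svalP W)) leqnn andbT.
by apply/subvP => v /vlineP[k ->]; exact: memvZ.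
Qed.

End Monomials.

(** * The anticanonical embedding *)

Lemma sval_inj (T : Type) (P : T -> Prop) : injective (sval : {x | P x} -> T).
Proof. by move=> [x px] [y py] /= e; exact: eq_exist. Qed.

Section Embedding.
Variables (R : realType) (n : nat) (Sigma : set (set 'rV[R]_n)).
Local Notation C := (R[i]).
Local Notation M := ('rV[int]_n).

(** [E] labels the maximal cones, the rows of [bas e] are the rays of such a cone, and [vert e] is
    the corresponding vertex of the anticanonical polytope. *)
Variables (E : Type) (bas : E -> 'M[int]_n) (vert : E -> M).

Definition polytope (m : M) := forall e i, -1 <= dot m (row i (bas e)).

Hypothesis ubas : forall e, bas e \in unitmx.
Hypothesis fan_cone : forall sigma, Sigma sigma ->
  exists e I, sigma = cone R (rays (bas e) I).
Hypothesis vertE : forall e i, dot (vert e) (row i (bas e)) = -1.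
(** Strict convexity of the anticanonical support function: on rays outside its cone a vertex
    exceeds -1, so by integrality it is at least 0. *)
Hypothesis vert_sep : forall e e' i,
  (exists j, row i (bas e') = row j (bas e)) \/
  0 <= dot (vert e) (row i (bas e')).
Hypothesis edge_polytope : forall e i,
  polytope (vert e + row i (dual_basis (bas e))).

Lemma vert_polytope e : polytope (vert e).
Proof.
move=> e' i; case: (vert_sep e e' i) => [[j ->]|]; first by rewrite vertE.
exact: le_trans.
Qed.

(** [coordinates] admits every basis of N that generates the cone, not only [bas e]; the rays are
    nevertheless intrinsic to the cone. *)
Lemma eq_rays (A A' : 'M[int]_n) I I' : A \in unitmx -> A' \in unitmx ->
  cone R (rays A I) = cone R (rays A' I') -> rays A I = rays A' I'.
Proof. by move=> uA uA' e; apply/seteqP; split; apply: (sub_rays (R := R)). Qed.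

Definition frame sigma (A : 'M[int]_n) I :=
  [/\ Sigma sigma, A \in unitmx & sigma = cone R (rays A I)].

Lemma coordinates_rays sigma (A : 'M[int]_n) I : frame sigma A I ->
  exists e I', sigma = cone R (rays (bas e) I') /\ rays A I = rays (bas e) I'.
Proof.
move=> [/fan_cone[e [I' s]] uA s']; exists e, I'; split=> //.
by apply: eq_rays => //; rewrite -s.
Qed.

Lemma polytope_ray sigma (A : 'M[int]_n) I m j :
  frame sigma A I -> polytope m -> j \in I -> -1 <= dot m (row j A).
Proof.
move=> F Pm jI; have [e [I' [_ rr]]] := coordinates_rays F.
by have := raysP A jI; rewrite rr => -[k _ ->].
Qed.

Lemma rdot_vert e (u : 'rV[R]_n) :
  rdot (vert e) u = - \sum_i rdot (row i (dual_basis (bas e))) u.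
Proof.
rewrite (rdot_expandE (ubas e)) -sumrN; apply: eq_bigr => i _.
by rewrite vertE rmorphN rmorph1 mulrN1.
Qed.

Lemma le_rdot_vert e e' I (u : 'rV[R]_n) : cone R (rays (bas e) I) u ->
  rdot (vert e) u <= rdot (vert e') u.
Proof.
move=> /(rays_cone (ubas e)) h; rewrite rdot_vert -sumrN.
rewrite [leRHS](rdot_expandE (ubas e)) ler_sum // => i _.
rewrite -mulrN1 ler_wpM2l //; first exact: (h i).1.
by rewrite -[-1]/(- (1 : R)) -(rmorph1 intr) -rmorphN ler_int vert_polytope.
Qed.

(* On the first cone the linear function of a vertex is at most that of any  *)
(* other vertex; equality on the intersection forces the support of u.       *)
Lemma max_face e I e' I' (u : 'rV[R]_n) :
  cone R (rays (bas e) I) u -> cone R (rays (bas e') I') u ->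
  cone R (rays (bas e) I `&` rays (bas e') I') u.
Proof.
move=> cu cu'; have /(rays_cone (ubas e)) h := cu.
have /(rays_cone (ubas e')) h' := cu'.
pose a i := rdot (row i (dual_basis (bas e))) u.
have a0 i : 0 <= a i := (h i).1.
have s0 : \sum_i a i * (dot (vert e') (row i (bas e)) + 1)%:~R = 0.
  have := rdot_vert e u; rewrite (le_anti (introT andP
    (conj (le_rdot_vert e' cu) (le_rdot_vert e cu')))).
  rewrite (rdot_expandE (ubas e)) => /eqP; rewrite -subr_eq0 opprK.
  rewrite -big_split /= => /eqP s0; rewrite -[RHS]s0; apply: eq_bigr => i _.
  by rewrite rmorphD rmorph1 mulrDr mulr1.
have ge0 i : 0 <= a i * (dot (vert e') (row i (bas e)) + 1)%:~R.
  rewrite mulr_ge0 // ler0z; have := vert_polytope e' e i; lia.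
have t0 i : a i != 0 -> exists j, row i (bas e) = row j (bas e').
  move=> ai; case: (vert_sep e' e i) => // t.
  move/eqP: s0; rewrite psumr_eq0 // => /allP /(_ i (mem_index_enum i)).
  rewrite /= mulf_eq0 (negPf ai) intr_eq0 /=; lia.
rewrite (rdot_expand (ubas e) u); apply: cone_sum => // i ai; split.
  by apply: raysP; apply: contraNT ai => /(h i).2 ->.
have [j ij] := t0 i ai; rewrite ij; apply: raysP.
suff : 0 < rdot (row j (dual_basis (bas e'))) u.
  by apply: contraTT => /(h' j).2 ->; rewrite ltxx.
rewrite (rdot_expandE (ubas e)) (bigD1 i) //= -/(a i) ltr_wpDr //.
  apply: sumr_ge0 => k _; rewrite -/(a k); have [->|/t0[l ->]] := eqVneq (a k) 0.
    by rewrite mul0r.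
  by rewrite dot_dual_basis // mulr_ge0 // ler0z.
by rewrite ij dot_dual_basis // eqxx mulr1 lt0r ai a0.
Qed.

(** By [max_face] the intersection lies in the cone over the common rays, so regularity on an
    overlap is tested on these rays alone. *)
Lemma dual_face sigma (A : 'M[int]_n) I sigma' (A' : 'M[int]_n) I' m :
  frame sigma A I ->
  frame sigma' A' I' ->
  (forall q, rays A I q -> rays A' I' q -> 0 <= dot m q) ->
  dual_monoid (sigma `&` sigma') m.
Proof.
move=> F F' h; have [e [J [sJ rJ]]] := coordinates_rays F.
have [e' [J' [sJ' rJ']]] := coordinates_rays F'.
apply: (@dual_monoidS _ _ _ (cone R (rays A I `&` rays A' I'))).
  by rewrite rJ rJ' => u [Su Su']; apply: max_face; rewrite -?sJ -?sJ'.
by apply/dual_cone => q [? ?]; exact: h.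
Qed.

(** * Sections of the anticanonical bundle *)

Definition dual_sum (A : 'M[int]_n) : M := \sum_i row i (dual_basis A).

Lemma dot_dual_sum A j : A \in unitmx -> dot (dual_sum A) (row j A) = 1.
Proof.
move=> uA; rewrite dot_suml (bigD1 j) //= dot_dual_basis // eqxx.
by rewrite big1 ?addr0 // => i ij; rewrite dot_dual_basis // (negPf ij).
Qed.

(** [dual_sum A] is the exponent of x_1 ... x_n, the factor between d/dx_i and x_i d/dx_i. Hence the
    section of [vert e] is a nonzero constant on the chart of e. *)
Lemma dual_sum_bas e : dual_sum (bas e) = - vert e.
Proof.
apply: (dot_inj (ubas e)) => i.
by rewrite dot_dual_sum // dotNl vertE opprK.
Qed.

(* The section chi^m (x_1 d/dx_1 /\ ... /\ x_n d/dx_n), up to the sign by   *)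
(* which the invariant n-vector depends on the coordinates.                  *)
Definition section_of (m : M) : presection R n :=
  fun _ A g => (\det A)%:~R * g (m + dual_sum A).

Lemma section_dual sigma (A : 'M[int]_n) I m : frame sigma A I -> polytope m ->
  dual_monoid sigma (m + dual_sum A).
Proof.
move=> F Pm; case: (F) => _ uA ->; apply/dual_rays => j jI.
rewrite dotDl dot_dual_sum //; have := polytope_ray F Pm jI; lia.
Qed.

Lemma section_coord_ring sigma (A : 'M[int]_n) I m : frame sigma A I -> polytope m ->
  coord_ring sigma (section_of m sigma A).
Proof.
move=> F Pm; exists 1, (fun=> (\det A)%:~R), (fun=> m + dual_sum A).
by split=> [_|g]; [exact: section_dual F Pm|rewrite big_ord1].
Qed.

(** Inversion in [int] is the identity map, as suits the units 1 and -1. *)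
Lemma det_dual_basis (A : 'M[int]_n) : \det (dual_basis A) = \det A.
Proof. by rewrite det_tr det_inv. Qed.

Lemma det_sqr (A : 'M[int]_n) : A \in unitmx -> \det A * \det A = 1.
Proof. by rewrite unitmxE => /mulrV. Qed.

(** In the Leibniz expansion the exponents of a term add up to [dual_sum A' - dual_sum A] whatever
    the permutation, so the character factors out and an integral determinant remains. Terms with a
    zero coefficient, whose characters may be undefined on [tau], drop out. *)
Lemma det_jacobian (A A' : 'M[int]_n) tau (d : M -> C) :
  A \in unitmx -> A' \in unitmx -> monoid_hom tau d ->
  (forall i j, dot (row i (dual_basis A')) (row j A) != 0 ->
     dual_monoid tau (row i (dual_basis A') - row j (dual_basis A))) ->
  \det (jacobian A A' d) =
  (\det A' * \det A)%:~R * d (dual_sum A' - dual_sum A).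
Proof.
move=> uA uA' hd h.
pose B := \matrix_(i, j) dot (row i (dual_basis A')) (row j A).
have -> : \det A' * \det A = \det B.
  rewrite -(det_dual_basis A') -(det_tr A) -det_mulmx; congr (\det _).
  by apply/matrixP => i j; rewrite !mxE; apply: eq_bigr => l _; rewrite !mxE.
rewrite /determinant rmorph_sum mulr_suml; apply: eq_bigr => s _.
rewrite rmorphM rmorphXn rmorphN rmorph1 -mulrA; congr (_ * _).
rewrite rmorph_prod.
have [z|nz] := eqVneq (\prod_i B i (s i)) 0.
  rewrite -rmorph_prod z rmorph0 mul0r.
  have /eqP/prodf_eq0 [i _ /eqP bi] := z.
  rewrite (bigD1 i) //= mxE (_ : \sum_l _ = B i (s i)).
    by rewrite bi rmorph0 !mul0r.
  by rewrite mxE; apply: eq_bigr => l _; rewrite !mxE.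
have -> : dual_sum A' - dual_sum A =
    \sum_i (row i (dual_basis A') - row (s i) (dual_basis A)).
  by rewrite sumrB; congr (_ - _); rewrite /dual_sum (reindex_perm s).
rewrite (hom_sum _ hd) => [|i _].
  rewrite -big_split; apply: eq_bigr => i _; rewrite mxE; congr (_%:~R * _).
  by rewrite mxE; apply: eq_bigr => l _; rewrite !mxE.
apply: h; move: nz; rewrite prodf_seq_neq0 => /allP /(_ i (mem_index_enum i)).
by rewrite mxE.
Qed.

Lemma section_transition sigma (A : 'M[int]_n) I sigma' (A' : 'M[int]_n) I' m d :
  frame sigma A I ->
  frame sigma' A' I' ->
  polytope m -> monoid_hom (sigma `&` sigma') d ->
  section_of m sigma' A' d = \det (jacobian A A' d) * section_of m sigma A d.
Proof.
move=> F F' Pm hd; have [[_ uA _] [_ uA' _]] := (F, F').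
rewrite (@det_jacobian A A' (sigma `&` sigma')) //; last first.
  (* On a common ray, m'_i - m_j could be negative only if the ray is row j of [A] and not row i of
     [A']; then the coefficient [nz] speaks of would be 0. *)
  move=> i j nz; apply: (dual_face F F').
  move=> _ [l lI ->] [l' lI' e]; rewrite dotBl [in X in X - _]e !dot_dual_basis //.
  case: (eqVneq j l) => [jl|_]; last by case: (i == l').
  by move: nz; rewrite jl e dot_dual_basis //; case: (i == l').
rewrite /section_of mulrACA -rmorphM -mulrA det_sqr // mulr1.
congr (_ * _); case: (hd) => _ hD _; rewrite -hD.
- by rewrite addrCA subrK.
- apply: (dual_face F F').
  move=> _ [l lI ->] [l' lI' e]; rewrite dotBl [in X in X - _]e.
  by rewrite !dot_dual_sum.
- by apply: (dual_monoidS (@subIsetl _ _ _)); exact: section_dual F Pm.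
Qed.

(** * Homogeneous coordinates and gluing *)

Variables (r : nat) (pt : 'I_r.+1 -> M).
Hypothesis ptP : forall m, polytope m <-> exists i, pt i = m.

Lemma pt_polytope i : polytope (pt i).
Proof. by apply/ptP; exists i. Qed.

Definition coord_row sigma A g : 'rV[C]_r.+1 :=
  \row_i section_of (pt i) sigma A g.

Lemma section_vert sigma e m g :
  section_of (vert e + m) sigma (bas e) g = (\det (bas e))%:~R * g m.
Proof. by rewrite /section_of dual_sum_bas addrAC subrr add0r. Qed.

Lemma det_neq0 (A : 'M[int]_n) : A \in unitmx -> (\det A)%:~R != 0 :> C.
Proof.
by move=> uA; rewrite intr_eq0; apply: contraTneq uA => z; rewrite unitmxE z.
Qed.

Lemma glued_coord_row sigma (A : 'M[int]_n) I sigma' (A' : 'M[int]_n) I' g g' :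
  frame sigma A I -> frame sigma' A' I' -> glued (sigma, g) (sigma', g') ->
  exists c, coord_row sigma' A' g' = c *: coord_row sigma A g.
Proof.
move=> F F' [d hd [/= dg dg']]; exists (\det (jacobian A A' d)).
apply/rowP => i; have Pm := pt_polytope i.
rewrite !mxE; have := section_transition F F' Pm hd; rewrite /section_of.
by rewrite (dg _ (section_dual F Pm)) (dg' _ (section_dual F' Pm)).
Qed.

Lemma glued_refl (p : chart_point R n) : monoid_hom p.1 p.2 -> glued p p.
Proof. by move=> hp; exists p.2; rewrite ?setIid. Qed.

Lemma glued_sym (p q : chart_point R n) : glued p q -> glued q p.
Proof. by move=> [d hd [? ?]]; exists d; rewrite 1?setIC. Qed.

Lemma pt_vert e : exists i, pt i = vert e.
Proof. by apply/ptP; exact: vert_polytope. Qed.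

Lemma pt_edge e j : exists i, pt i = vert e + row j (dual_basis (bas e)).
Proof. by apply/ptP; exact: edge_polytope. Qed.

(** Gluing the point to itself changes the coordinates to [bas e], where the entry of [vert e] is a
    nonzero determinant. *)
Lemma coord_row_neq0 sigma (A : 'M[int]_n) I g : frame sigma A I ->
  monoid_hom sigma g -> coord_row sigma A g != 0.
Proof.
move=> F hg; have [e [J [sJ _]]] := coordinates_rays F.
have F' : frame sigma (bas e) J by case: F.
have [c] := glued_coord_row F F' (glued_refl (p := (_, _)) hg).
apply: contra_eqN => /eqP ->; rewrite scaler0; have [i ie] := pt_vert e.
apply/eqP => /rowP/(_ i); rewrite !mxE ie -[vert e]addr0 section_vert.
by case: hg => -> _ _; rewrite mulr1; apply/eqP; exact: det_neq0.
Qed.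

Lemma section_zero e I m g i : polytope m ->
  monoid_hom (cone R (rays (bas e) I)) g ->
  section_of m (cone R (rays (bas e) I)) (bas e) g != 0 ->
  g (row i (dual_basis (bas e))) = 0 -> dot m (row i (bas e)) = -1.
Proof.
move=> Pm hg; rewrite /section_of (chart_expand (ubas e) hg); last first.
  by apply/dual_rays => j _; rewrite dotDl dot_dual_sum //; have := Pm e j; lia.
rewrite mulf_eq0 negb_or => /andP[_ /prodf_neq0 /(_ i isT)] + gi.
rewrite gi dotDl dot_dual_sum // exp0rz addr_eq0.
by have [//|_] := eqVneq (dot m (row i (bas e))) (-1); rewrite eqxx.
Qed.

(** This yields injectivity of the embedding: the coordinates of [g] define a homomorphism on the
    overlap, and ratios of sections show that it also restricts to [g']. *)
Lemma coord_row_glued_bas e I e' I' g g' (c : C) :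
  let sigma := cone R (rays (bas e) I) in
  let sigma' := cone R (rays (bas e') I') in
  monoid_hom sigma g -> monoid_hom sigma' g' -> c != 0 ->
  coord_row sigma' (bas e') g' = c *: coord_row sigma (bas e) g ->
  glued (sigma, g) (sigma', g').
Proof.
move=> sigma sigma' hg hg' c0 /rowP ec.
have {}ec m : polytope m -> section_of m sigma' (bas e') g' =
   c * section_of m sigma (bas e) g.
  by move=> /ptP[i <-]; have := ec i; rewrite !mxE.
pose x i := g (row i (dual_basis (bas e))).
have nz m i : polytope m -> section_of m sigma' (bas e') g' != 0 ->
   x i = 0 -> dot m (row i (bas e)) = -1.
  move=> Pm; rewrite ec // mulf_eq0 negb_or => /andP[_ sm].
  exact: (section_zero Pm hg sm).
have xI i : x i = 0 -> i \in I.
  by move=> xi; apply: contra_eqT xi => iI; exact: chart_neq0 hg iI.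
have g'0 : g' 0 = 1 by case: hg'.
(* Were ray i not in the second cone, the section of [vert e'], or of a neighbour of it, would be
   nonzero at the point and pair to at least 0 with the ray, against [nz]. *)
have xI' i : x i = 0 -> rays (bas e') I' (row i (bas e)).
  move=> xi; case: (vert_sep e' e i) => [[j ij]|ge0].
    have [jI|jI] := boolP (j \in I'); first by rewrite ij; exact: raysP.
    have := nz _ i (edge_polytope e' j) _ xi.
    rewrite section_vert mulf_neq0 ?det_neq0 //; last exact: chart_neq0 hg' jI.
    by rewrite ij dotDl vertE dot_dual_basis // eqxx addNr => /(_ isT).
  have := nz _ i (vert_polytope e') _ xi.
  rewrite -{1}[vert e']addr0 section_vert g'0 mulr1 det_neq0 // => /(_ isT).
  by move: ge0 => /[swap] ->.
pose d := point_of (sigma `&` sigma') (bas e) x.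
have hd : monoid_hom (sigma `&` sigma') d.
  apply: point_of_hom => i xi; split; apply: cone_gen; last exact: xI'.
  by apply: raysP; exact: xI.
have dg m : dual_monoid sigma m -> d m = g m.
  move=> dm; apply/esym/(eq_hom (ubas e) hg hd (@subIsetl _ _ _)).
  - exact: dual_row.
  - move=> i; rewrite /d point_ofE ?monomial_dual_row //.
    by apply: (dual_monoidS (@subIsetl _ _ _)); exact: dual_row.
  - exact: dual_row_or.
exists d => //; split=> [|m dm]; first exact: dg.
apply/esym/(eq_hom (ubas e') hg' hd (@subIsetr _ _ _)).
- exact: dual_row.
- move=> j; have dj : dual_monoid (sigma `&` sigma') (row j (dual_basis (bas e'))).
    by apply: (dual_monoidS (@subIsetr _ _ _)); exact: dual_row.
  have dS n' : polytope n' -> dual_monoid sigma (n' + dual_sum (bas e)).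
    move=> Pn; apply/dual_rays => k _; rewrite dotDl dot_dual_sum //.
    by have := Pn e k; lia.
  (* The coordinate j of [g'] is the ratio of the sections at [vert e'] and at its j-th neighbour;
     the factor [c] cancels. *)
  have := ec _ (edge_polytope e' j); rewrite section_vert {1}/section_of.
  rewrite -dg; last exact/dS/edge_polytope.
  have [_ dD _] := hd; rewrite addrAC dD //; last first.
    by apply: (dual_monoidS (@subIsetl _ _ _)); exact/dS/vert_polytope.
  have := ec _ (vert_polytope e').
  rewrite -{1}[vert e']addr0 section_vert g'0 mulr1 {1}/section_of.
  rewrite -dg; last exact/dS/vert_polytope.
  by move=> e1; rewrite (mulrA _%:~R) (mulrA c) -e1; apply: mulfI; exact: det_neq0.
- exact: dual_row_or.
Qed.

Lemma coord_row_glued sigma (A : 'M[int]_n) I sigma' (A' : 'M[int]_n) I' g g' (c : C) :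
  frame sigma A I -> frame sigma' A' I' ->
  monoid_hom sigma g -> monoid_hom sigma' g' -> c != 0 ->
  coord_row sigma' A' g' = c *: coord_row sigma A g ->
  glued (sigma, g) (sigma', g').
Proof.
move=> F F' hg hg' c0 ec; have [[S uA s] [S' uA' s']] := (F, F').
have [e [J [sJ _]]] := coordinates_rays F.
have [e' [J' [sJ' _]]] := coordinates_rays F'.
have F1 : frame sigma (bas e) J by [].
have F1' : frame sigma' (bas e') J' by [].
have [a ea] := glued_coord_row F1 F (glued_refl (p := (_, _)) hg).
have [b eb] := glued_coord_row F' F1' (glued_refl (p := (_, _)) hg').
have e1 : coord_row sigma' (bas e') g' = (b * c * a) *: coord_row sigma (bas e) g.
  by rewrite eb ec ea !scalerA.
rewrite sJ sJ'; apply: (@coord_row_glued_bas _ _ _ _ _ _ (b * c * a)); rewrite -?sJ -?sJ' //.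
apply/eqP => z; move: e1; rewrite z scale0r; apply/eqP.
exact: coord_row_neq0 F1' hg'.
Qed.

(** * The binomial equations of the image *)

Definition weight (a : 'X_{1..r.+1}) : M := \sum_i pt i *+ a i.

Lemma weightD a b : weight (a + b)%MM = weight a + weight b.
Proof. by rewrite -big_split; apply: eq_bigr => i _; rewrite mnmDE mulrnDr. Qed.

Lemma weight0 : weight 0%MM = 0.
Proof. by apply: big1 => i _; rewrite mnm0E. Qed.

Lemma weightU i : weight U_(i)%MM = pt i.
Proof.
rewrite /weight (bigD1 i) //= mnm1E eqxx big1 ?addr0 // => j ji.
by rewrite mnm1E eq_sym (negPf ji).
Qed.

Lemma weightMn a k : weight (a *+ k)%MM = weight a *+ k.
Proof. by rewrite -sumrMnl; apply: eq_bigr => i _; rewrite mulmnE mulrnA. Qed.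

Lemma weight_sum (T : Type) (s : seq T) (F : T -> 'X_{1..r.+1}) :
  weight (\sum_(i <- s) F i)%MM = \sum_(i <- s) weight (F i).
Proof. by apply: (big_morph weight) => [a b|]; rewrite ?weightD ?weight0. Qed.

(** The value depends only on degree and weight, whence the binomial relations. *)
Lemma mpow_coord_row sigma (A : 'M[int]_n) I g a : frame sigma A I ->
  monoid_hom sigma g ->
  mpow (coord_row sigma A g) a =
  (\det A)%:~R ^+ mdeg a * g (weight a + dual_sum A *+ mdeg a).
Proof.
move=> F hg; rewrite mdegE expr_sum -sumrMnr -big_split /= (hom_sum _ hg).
  rewrite -big_split; apply: eq_bigr => i _; rewrite mxE exprMn -mulrnDl.
  by rewrite (hom_mulrn _ hg) //; exact: section_dual F (pt_polytope i).
move=> i _; rewrite -mulrnDl; apply: dual_monoidMn.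
exact: section_dual F (pt_polytope i).
Qed.

Definition binomial_eqs (w : 'rV[C]_r.+1) := forall a b,
  mdeg a = mdeg b -> weight a = weight b -> mpow w a = mpow w b.

Lemma coord_row_binomial sigma (A : 'M[int]_n) I g c : frame sigma A I ->
  monoid_hom sigma g -> binomial_eqs (c *: coord_row sigma A g).
Proof.
by move=> F hg a b dab wab; rewrite !mpowZ !(mpow_coord_row _ F hg) dab wab.
Qed.

Hypothesis extremal : forall m, polytope m ->
  (exists e, m = vert e) \/
  exists x, [/\ x != 0, polytope (m + x) & polytope (m - x)].

(* If m is not a vertex, w_m^2 = w_(m+x) w_(m-x), while |m+x|^2 + |m-x|^2    *)
(* exceeds 2|m|^2; hence a longest m with w_m nonzero is a vertex.           *)
Lemma binomial_vert w : w != 0 -> binomial_eqs w ->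
  exists e i, pt i = vert e /\ w ord0 i != 0.
Proof.
move=> w0 bw; have [i0 wi0] : exists i, w ord0 i != 0.
  apply/existsP; apply: contraNT w0; rewrite negb_exists => /forallP w0.
  by apply/eqP/rowP => i; rewrite mxE; apply/eqP/negPn.
pose N (i : 'I_r.+1) := dot (pt i) (pt i).
case: (@arg_maxP _ _ _ i0 (fun i => w ord0 i != 0) N wi0) => i wi maxi.
case: (extremal (pt_polytope i)) => [[e ie]|[x [x0 /ptP[j ej] /ptP[k ek]]]].
  by exists e, i.
have : mpow w (U_(i) *+ 2)%MM = mpow w (U_(j) + U_(k))%MM.
  apply: bw; first by rewrite mdegMn mdegD !mdeg1.
  by rewrite weightMn weightD !weightU ej ek addrACA subrr addr0 mulr2n.
rewrite mpowMn mpowD !mpowU => e2.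
have : w ord0 j * w ord0 k != 0 by rewrite -e2 expf_neq0.
rewrite mulf_eq0 negb_or => /andP[/maxi + /maxi].
rewrite /N ej ek !(dotDl, dotDr) !(dotNl, dotC _ (- x)) (dotC x).
have := dot_self_gt0 x0; rewrite (dotC _ x) /=; lia.
Qed.

Local Notation full := (finset.setTfor 'I_n).
Local Notation max_cone e := (cone R (rays (bas e) full)).

Hypothesis fan_max : forall e, Sigma (max_cone e).

Lemma frame_max e : frame (max_cone e) (bas e) full.
Proof. by []. Qed.

Definition vert_idx e : 'I_r.+1 := sval (cid (pt_vert e)).
Definition edge_idx e j : 'I_r.+1 := sval (cid (pt_edge e j)).

Lemma vert_idxE e : pt (vert_idx e) = vert e.
Proof. by rewrite /vert_idx; case: cid. Qed.

Lemma edge_idxE e j : pt (edge_idx e j) = vert e + row j (dual_basis (bas e)).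
Proof. by rewrite /edge_idx; case: cid. Qed.

(** [pt] may list a lattice point more than once; the linear binomials identify the copies. *)
Lemma binomial_pt_idx w i i' : binomial_eqs w -> pt i = pt i' ->
  w ord0 i = w ord0 i'.
Proof.
by move=> bw e; rewrite -!mpowU; apply: bw; rewrite ?mdeg1 // !weightU.
Qed.

Lemma point_of_max_hom e x : monoid_hom (max_cone e) (point_of (max_cone e) (bas e) x).
Proof.
by apply: point_of_hom => i _; apply: cone_gen; apply: raysP; rewrite finset.in_setT.
Qed.

Lemma binomial_chart w e : binomial_eqs w -> w ord0 (vert_idx e) != 0 ->
  exists g c, [/\ monoid_hom (max_cone e) g, c != 0 &
    w = c *: coord_row (max_cone e) (bas e) g].
Proof.
move=> bw wv; pose x j := w ord0 (edge_idx e j) / w ord0 (vert_idx e).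
pose D : C := (\det (bas e))%:~R; have D0 : D != 0 by exact: det_neq0.
exists (point_of (max_cone e) (bas e) x), (w ord0 (vert_idx e) / D).
split; [exact: point_of_max_hom|by rewrite mulf_neq0 ?invr_eq0|].
apply/rowP => i; rewrite !mxE /section_of -/D point_ofE; last first.
  exact: section_dual (frame_max e) (pt_polytope i).
rewrite mulrA divfK //.
pose k j := `|dot (pt i + dual_sum (bas e)) (row j (bas e))|%N.
have kE j : dot (pt i + dual_sum (bas e)) (row j (bas e)) = Posz (k j).
  rewrite /k gez0_abs // dotDl dot_dual_sum //.
  by have := pt_polytope i e j; lia.
have -> : monomial (bas e) x (pt i + dual_sum (bas e)) = \prod_j x j ^+ k j.
  by apply: eq_bigr => j _; rewrite kE.
(* With K the sum of the k_j, [pt i] plus K times the vertex equals the vertex plus the sum of k_j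
   times its j-th neighbour; this relation expresses [w] at i through the vertex and its
   neighbours. *)
have := bw (U_(i) + U_(vert_idx e) *+ \sum_j k j)%MM
  (U_(vert_idx e) + \sum_j U_(edge_idx e j) *+ k j)%MM.
rewrite !mpowD mpowMn mpow_sum !mpowU => eb.
under eq_bigr do rewrite expr_div_n.
rewrite prodf_div prodrXr mulrA; apply: (canRL (mulfK _)).
  by rewrite expf_neq0.
rewrite eb.
- by congr (_ * _); apply: eq_bigr => j _; rewrite mpowMn mpowU.
- rewrite !mdegD mdegMn mdeg_sum !mdeg1 mul1n; congr (_ + _)%N.
  by apply: eq_bigr => j _; rewrite mdegMn mdeg1 mul1n.
- rewrite !weightD weightMn weight_sum !weightU vert_idxE.
  have -> : \sum_j weight (U_(edge_idx e j) *+ k j)%MM =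
     vert e *+ (\sum_j k j) + \sum_j row j (dual_basis (bas e)) *+ k j.
    rewrite -sumrMnr -big_split; apply: eq_bigr => j _.
    by rewrite weightMn weightU edge_idxE mulrnDl.
  rewrite addrCA addrC; congr (_ + _).
  have := dual_basis_expand (ubas e) (pt i + dual_sum (bas e)).
  rewrite dual_sum_bas => /(canRL (subrK _)) ->; rewrite addrC; congr (_ + _).
  by apply: eq_bigr => j _; rewrite -dual_sum_bas kE -[Posz _]natz scaler_nat.
Qed.

Lemma chart_frame (p : chart_point R n) : is_chart_point Sigma p ->
  exists A I, frame p.1 A I.
Proof. by move=> [S _]; have [e [I s]] := fan_cone S; exists (bas e), I. Qed.

(** Homomorphisms on two overlaps do not directly give one on the third; transitivity is read off
    from proportionality of the coordinate rows. *)
Lemma glued_trans (p q s : chart_point R n) : is_chart_point Sigma p ->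
  is_chart_point Sigma q -> is_chart_point Sigma s ->
  glued p q -> glued q s -> glued p s.
Proof.
move: p q s => [sp gp] [sq gq] [ss gs] Cp Cq Cs pq qs.
have [[A [I Fp]] [B [J Fq]] [D [L Fs]]] :=
  And3 (chart_frame Cp) (chart_frame Cq) (chart_frame Cs).
have [c ec] := glued_coord_row Fp Fq pq.
have [d ed] := glued_coord_row Fq Fs qs.
apply: (coord_row_glued Fp Fs Cp.2 Cs.2 (c := d * c)); last by rewrite ed ec scalerA.
have := coord_row_neq0 Fs Cs.2; apply: contraNneq => z.
by rewrite ed ec scalerA z scale0r.
Qed.

(** * The map to projective space *)

Local Notation X := (toric_point Sigma).
Implicit Types (x y : X).

Lemma in_chartP x sigma g : in_chart x sigma g -> is_chart_point Sigma (sigma, g).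
Proof. by rewrite /in_chart; case: x => _ [p _ /= ->] []. Qed.

Lemma in_chart_glued x sigma g sigma' g' : in_chart x sigma g ->
  in_chart x sigma' g' -> glued (sigma, g) (sigma', g').
Proof.
rewrite /in_chart; case: x => _ [p Cp /= ->] [C1 G1] [C2 G2].
by apply: glued_trans C1 Cp C2 _ G2; exact: glued_sym.
Qed.

Lemma glued_in_chart x sigma g sigma' g' : in_chart x sigma g ->
  is_chart_point Sigma (sigma', g') -> glued (sigma, g) (sigma', g') ->
  in_chart x sigma' g'.
Proof.
rewrite /in_chart; case: x => _ [p Cp /= ->] [C1 G1] C2 G2; split=> //.
exact: glued_trans Cp C1 C2 G1 G2.
Qed.

Lemma exists_chart x : exists sigma g, in_chart x sigma g.
Proof.
rewrite /in_chart; case: x => _ [[sigma g] Cp /= ->]; exists sigma, g; split=> //.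
by apply: glued_refl; exact: Cp.2.
Qed.

Lemma chart_exists sigma g : is_chart_point Sigma (sigma, g) ->
  exists x, in_chart x sigma g.
Proof.
move=> Cp; have h : exists2 p, is_chart_point Sigma p &
  [set q | is_chart_point Sigma q /\ glued (sigma, g) q] =
  [set q | is_chart_point Sigma q /\ glued p q] by exists (sigma, g).
pose T (B : set (chart_point R n)) := exists2 p, is_chart_point Sigma p &
  B = [set q | is_chart_point Sigma q /\ glued p q].
exists (exist T _ h); split=> //; apply: glued_refl; exact: Cp.2.
Qed.

Lemma in_chart_inj x y sigma g : in_chart x sigma g -> in_chart y sigma g -> x = y.
Proof.
move=> xg yg; apply: sval_inj; apply/seteqP; split=> -[s h] xh.
  by apply: (glued_in_chart yg); [exact: in_chartP xh|exact: in_chart_glued xg xh].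
by apply: (glued_in_chart xg); [exact: in_chartP xh|exact: in_chart_glued yg xh].
Qed.

Lemma embedding_exists x : exists W : line C r, forall sigma g A I,
  in_chart x sigma g -> frame sigma A I -> sval W = <[coord_row sigma A g]>%VS.
Proof.
have [s [h xh]] := exists_chart x; have [B [J F]] := chart_frame (in_chartP xh).
have nz : coord_row s B h != 0 by apply: (coord_row_neq0 F); exact: (in_chartP xh).2.
have d1 : \dim <[coord_row s B h]> == 1%N by rewrite dim_vline nz.
exists (exist (fun V : {vspace 'rV[C]_r.+1} => \dim V == 1%N) _ d1) => sigma g A I xg F' /=.
have [c ec] := glued_coord_row F F' (in_chart_glued xh xg).
rewrite ec vlineZ //; have := coord_row_neq0 F' (in_chartP xg).2.
by apply: contraNneq => c0; rewrite ec c0 scale0r.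
Qed.

Definition embedding x : line C r := sval (cid (embedding_exists x)).

Lemma embeddingE x sigma g A I : in_chart x sigma g -> frame sigma A I ->
  sval (embedding x) = <[coord_row sigma A g]>%VS.
Proof. by rewrite /embedding; case: cid => W /= h; exact: h. Qed.

Lemma embedding_binomial x w : w \in sval (embedding x) -> binomial_eqs w.
Proof.
have [s [h xh]] := exists_chart x; have [A [I F]] := chart_frame (in_chartP xh).
rewrite (embeddingE xh F) => /vlineP[c ->].
exact: coord_row_binomial F (in_chartP xh).2.
Qed.

Lemma embedding_glued x w c sigma g A I : w \in sval (embedding x) -> w != 0 ->
  frame sigma A I -> monoid_hom sigma g -> w = c *: coord_row sigma A g ->
  in_chart x sigma g.
Proof.
move=> + w0 F hg ec; have [s [h xh]] := exists_chart x.
have [B [J F']] := chart_frame (in_chartP xh).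
rewrite (embeddingE xh F') => /vlineP[d ed].
have c0 : c != 0 by apply: contraNneq w0 => c0; rewrite ec c0 scale0r.
have d0 : d != 0 by apply: contraNneq w0 => d0; rewrite ed d0 scale0r.
apply: (glued_in_chart xh); first by split=> //; case: F.
apply: (coord_row_glued F' F (in_chartP xh).2 hg (c := c^-1 * d)).
  by rewrite mulf_neq0 ?invr_eq0.
by rewrite -scalerA -ed ec scalerA mulVf // scale1r.
Qed.

Lemma embedding_inj : injective embedding.
Proof.
move=> x y e; have [s [h xh]] := exists_chart x.
have [A [I F]] := chart_frame (in_chartP xh).
apply: (in_chart_inj xh).
apply: (embedding_glued (w := coord_row s A h) (c := 1) _ _ F); rewrite ?scale1r //.
- by rewrite -e (embeddingE xh F) memv_line.
- exact: coord_row_neq0 F (in_chartP xh).2.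
- exact: (in_chartP xh).2.
Qed.

Lemma embedding_chart x w e : w \in sval (embedding x) ->
  w ord0 (vert_idx e) != 0 -> exists g, in_chart x (max_cone e) g.
Proof.
move=> xw wv; have [g [c [hg c0 ew]]] := binomial_chart (embedding_binomial xw) wv.
exists g; apply: (embedding_glued xw _ (frame_max e) hg ew).
by apply: contraNneq wv => ->; rewrite mxE.
Qed.

Lemma embedding_range (W : line C r) : (forall w, w \in sval W -> binomial_eqs w) ->
  exists x, embedding x = W.
Proof.
move=> bW; pose w := vpick (sval W).
have wW : w \in sval W by exact: memv_pick.
have w0 : w != 0 by rewrite vpick0 -dimv_eq0 (eqP (svalP W)).
have [e [i [ie wi]]] := binomial_vert w0 (bW w wW).
have wv : w ord0 (vert_idx e) != 0.
  by rewrite (@binomial_pt_idx _ _ i (bW w wW)) // vert_idxE.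
have [g [c [hg c0 ew]]] := binomial_chart (bW w wW) wv.
have [x xg] : exists x, in_chart x (max_cone e) g.
  by apply: chart_exists; split=> //; exact: fan_max.
exists x; apply: sval_inj.
by rewrite (embeddingE xg (frame_max e)) (lineP wW w0) ew vlineZ.
Qed.

(** * Comparison of open sets and regular functions *)

Lemma coord_ring_pullback sigma (A : 'M[int]_n) I (p : {mpoly C[r.+1]}) :
  frame sigma A I ->
  exists2 h, coord_ring sigma h &
    forall g, monoid_hom sigma g -> h g = evalp p (coord_row sigma A g).
Proof.
move=> F; pose a (t : 'I_(size (msupp p))) := nth 0%MM (msupp p) t.
pose c t : C := p@_(a t) * (\det A)%:~R ^+ mdeg (a t).
pose m t := weight (a t) + dual_sum A *+ mdeg (a t).
exists (fun g => \sum_t c t * g (m t)) => [|g hg].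
  exists (size (msupp p)), c, m; split=> // t.
  rewrite /m mdegE -sumrMnr -big_split; apply: dual_monoid_sum => i _ /=.
  rewrite -mulrnDl; apply: dual_monoidMn.
  exact: section_dual F (pt_polytope i).
rewrite evalpE (big_nth 0%MM) big_mkord; apply: eq_bigr => t _.
by rewrite (mpow_coord_row _ F hg) mulrA.
Qed.

(** Denominators are cleared by a power of the vertex coordinate. One spare factor makes the
    polynomial vanish off the chart, and the freedom in D lets a numerator and a denominator share
    their degree. *)
Lemma coord_ring_homogenize e h : coord_ring (max_cone e) h ->
  exists D0, forall D, (D0 <= D)%N -> exists P : {mpoly C[r.+1]},
    [/\ P \is D.+1.-homog,
        forall w : 'rV[C]_r.+1, w ord0 (vert_idx e) = 0 -> evalp P w = 0
      & forall x g w, in_chart x (max_cone e) g -> w \in sval (embedding x) ->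
          evalp P w = w ord0 (vert_idx e) ^+ D.+1 * h g].
Proof.
move=> [s [c [m [dm hE]]]].
pose k t j := `|dot (m t) (row j (bas e))|%N; pose deg t := (\sum_j k t j)%N.
have kE t j : dot (m t) (row j (bas e)) = Posz (k t j).
  rewrite /k gez0_abs //; have /dual_rays := dm t; apply.
  by rewrite finset.in_setT.
exists (\sum_t deg t)%N => D leD; have degD t : (deg t <= D)%N.
  by apply: leq_trans leD; rewrite (bigD1 t) //= leq_addr.
pose a t := (U_(vert_idx e) *+ (D.+1 - deg t) + \sum_j U_(edge_idx e j) *+ k t j)%MM.
have aE w t : mpow w (a t) = w ord0 (vert_idx e) ^+ (D.+1 - deg t) *
    \prod_j w ord0 (edge_idx e j) ^+ k t j.
  rewrite mpowD mpowMn mpowU mpow_sum; congr (_ * _).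
  by apply: eq_bigr => j _; rewrite mpowMn mpowU.
exists (\sum_t c t *: 'X_[a t]).
have PE w : evalp (\sum_t c t *: 'X_[a t]) w = \sum_t c t * mpow w (a t).
  rewrite /evalp raddf_sum; apply: eq_bigr => t _.
  by rewrite /= mevalZ -/(evalp _ _) evalpX.
split=> [|w wv|x g w xg].
- apply: rpred_sum => t _; apply: dhomogZ; rewrite dhomogX; apply/eqP.
  rewrite -[LHS]/(mdeg (a t)) /a mdegD mdegMn mdeg1 mul1n mdeg_sum.
  under eq_bigr do rewrite mdegMn mdeg1 mul1n.
  by rewrite subnK // (leq_trans (degD t)).
- rewrite PE big1 // => t _.
  by rewrite aE wv subSn // expr0n mul0r mulr0.
- rewrite (embeddingE xg (frame_max e)) => /vlineP[b ->].
  rewrite PE hE mulr_sumr; apply: eq_bigr => t _; rewrite mulrCA; congr (_ * _).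
  rewrite aE; set u := b *: _; set v := u ord0 _.
  have hg : monoid_hom (max_cone e) g := (in_chartP xg).2.
  have ve j : u ord0 (edge_idx e j) = v * g (row j (dual_basis (bas e))).
    rewrite /v /u !mxE edge_idxE vert_idxE -[X in _ = _ * section_of X _ _ _ * _]addr0.
    by rewrite !section_vert -!mulrA; case: hg => -> _ _; rewrite mul1r.
  under eq_bigr do rewrite ve exprMn.
  rewrite big_split /= prodrXr mulrA -exprD subnK ?(leq_trans (degD t)) //.
  congr (_ * _); rewrite (chart_expand (ubas e) hg) //.
  by apply: eq_bigr => j _; rewrite kE.
Qed.

Lemma max_chart_neq0 x e g w : in_chart x (max_cone e) g ->
  w \in sval (embedding x) -> w != 0 -> w ord0 (vert_idx e) != 0.
Proof.
move=> xg; rewrite (embeddingE xg (frame_max e)) => /vlineP[b ->].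
rewrite scaler_eq0 negb_or => /andP[b0 _].
rewrite !mxE vert_idxE -[vert e]addr0 section_vert.
have hg : monoid_hom (max_cone e) g := (in_chartP xg).2.
by case: hg => -> _ _; rewrite mulr1 mulf_neq0 ?det_neq0.
Qed.

Lemma exists_max_chart x : exists e g, in_chart x (max_cone e) g.
Proof.
have [s [h xh]] := exists_chart x; have [A [I F]] := chart_frame (in_chartP xh).
have nz := coord_row_neq0 F (in_chartP xh).2.
have xw : coord_row s A h \in sval (embedding x).
  by rewrite (embeddingE xh F) memv_line.
have [e [i [ie wi]]] := binomial_vert nz (embedding_binomial xw).
exists e; apply: (embedding_chart xw).
by rewrite (@binomial_pt_idx _ _ i (embedding_binomial xw)) // vert_idxE.
Qed.

(** As the homogenized polynomial vanishes where the vertex coordinate does, its nonvanishing locus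
    stays inside the chart, where openness of [U] applies. *)
Lemma toric_open_homog U x : toric_open U -> U x ->
  exists d P, [/\ P \is d.-homog,
    exists2 w, w \in sval (embedding x) & w != 0 /\ evalp P w != 0
    & forall y w, w \in sval (embedding y) -> evalp P w != 0 -> U y].
Proof.
move=> oU Ux; have [e [g xg]] := exists_max_chart x.
have [h [Ch hg hU]] := oU _ _ _ Ux xg.
have [D hD] := coord_ring_homogenize Ch; have [P [hP P0 PE]] := hD _ (leqnn D).
exists D.+1, P; split=> // [|y w yw Pw].
  have w0 := coord_row_neq0 (frame_max e) (in_chartP xg).2.
  have xw : coord_row (max_cone e) (bas e) g \in sval (embedding x).
    by rewrite (embeddingE xg (frame_max e)) memv_line.
  exists (coord_row (max_cone e) (bas e) g) => //; split=> //.
  by rewrite (PE _ _ _ xg xw) mulf_neq0 // expf_neq0 // (max_chart_neq0 xg xw).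
have [g' yg'] : exists g', in_chart y (max_cone e) g'.
  by apply: (embedding_chart yw); apply: contraNneq Pw => /P0 ->.
apply: (hU _ _ yg'); apply: contraNneq Pw => h0.
by rewrite (PE _ _ _ yg' yw) h0 mulr0.
Qed.

Lemma embedding_closed : proj_open (~` range embedding).
Proof.
exists [set p | exists a b, [/\ mdeg a = mdeg b, weight a = weight b
   & p = 'X_[a] - 'X_[b]]].
  move=> _ [a [b [dab _ ->]]]; exists (mdeg a).
  by apply: rpredB; rewrite dhomogX //; apply/eqP.
move=> W; have eE a b w : evalp ('X_[a] - 'X_[b]) w = mpow w a - mpow w b.
  by rewrite /evalp mevalB -!/(evalp _ _) !evalpX.
split=> [nW|[_ [w [[a [b [dab wab ->]]] wW]]] + [x _ xW]].
  apply: contrapT => nb; apply: nW.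
  suff [x xW] : exists x, embedding x = W by exists x.
  apply: embedding_range => w wW a b dab wab; apply/eqP/negPn/negP => ab.
  apply: nb; exists ('X_[a] - 'X_[b]), w; split=> //; first by exists a, b.
  by rewrite eE subr_eq0.
move: wW; rewrite -xW => /embedding_binomial /(_ a b dab wab) e.
by rewrite eE e subrr eqxx.
Qed.

Lemma evalp_row (p : {mpoly C[r.+1]}) d x w sigma g A I : p \is d.-homog ->
  w \in sval (embedding x) -> evalp p w != 0 -> in_chart x sigma g ->
  frame sigma A I -> evalp p (coord_row sigma A g) != 0.
Proof.
move=> hp xw pw xg F; move: xw pw; rewrite (embeddingE xg F) => /vlineP[c ->].
by rewrite (evalp_homog _ _ hp); apply: contraNneq => ->; rewrite mulr0.
Qed.

Lemma embedding_continuous V : proj_open V -> toric_open (embedding @^-1` V).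
Proof.
move=> [S hS VS] x sigma g /VS[p [w [Sp xw pw]]] xg.
have [A [I F]] := chart_frame (in_chartP xg); have [d hp] := hS p Sp.
have [h Ch hE] := coord_ring_pullback p F; exists h; split=> //.
  by rewrite hE ?(evalp_row hp xw pw xg F) //; exact: (in_chartP xg).2.
move=> y g' yg'; rewrite hE; last exact: (in_chartP yg').2.
move=> pw'; apply/VS; exists p, (coord_row sigma A g'); split=> //.
by rewrite (embeddingE yg' F) memv_line.
Qed.

Lemma embedding_regular V f : proj_regular V f ->
  toric_regular (embedding @^-1` V) (f \o embedding).
Proof.
move=> rf x sigma g /rf[d [p [q [hp hq [w xw qw] fE]]]] xg.
have [A [I F]] := chart_frame (in_chartP xg).
have [a Ca aE] := coord_ring_pullback p F.
have [h Ch hE] := coord_ring_pullback q F; exists a, h; split=> //.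
  by rewrite hE ?(evalp_row hq xw qw xg F) //; exact: (in_chartP xg).2.
move=> y g' yg' Vy; have hg' := (in_chartP yg').2.
rewrite aE // hE // => q0; apply: fE => //; last exact: (coord_row_neq0 F).
by rewrite (embeddingE yg' F) memv_line.
Qed.

Lemma embedding_open U : toric_open U ->
  exists2 V, proj_open V & embedding @^-1` V = U.
Proof.
move=> oU; pose S := [set p : {mpoly C[r.+1]} | (exists d, p \is d.-homog) /\
  forall y w, w \in sval (embedding y) -> evalp p w != 0 -> U y].
exists [set W : line C r | exists p w, [/\ S p, w \in sval W & evalp p w != 0]].
  by exists S => // p [].
apply/seteqP; split=> [x [p [w [[_ pU] xw pw]]]|x Ux]; first exact: pU xw pw.
have [d [P [hP [w xw [_ Pw]] PU]]] := toric_open_homog oU Ux.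
by exists P, w; split=> //; split=> //; exists d.
Qed.

Lemma embedding_regular_local U f x : toric_open U -> toric_regular U f -> U x ->
  exists V g, [/\ proj_open V, V (embedding x), embedding @^-1` V `<=` U,
    proj_regular V g & forall y, V (embedding y) -> g (embedding y) = f y].
Proof.
move=> oU rf Ux; have [e [g xg]] := exists_max_chart x.
have [a [h [Ca Ch hg fE]]] := rf _ _ _ Ux xg.
have [D1 h1] := coord_ring_homogenize Ca; have [D2 h2] := coord_ring_homogenize Ch.
pose D := maxn D1 D2; have [Pa [ha a0 aE]] := h1 D (leq_maxl _ _).
have [Ph [hh hh0 hE]] := h2 D (leq_maxr _ _).
have [d [P [hP [w xw [w0 Pw]] PU]]] := toric_open_homog oU Ux.
have evalPh v : evalp (P * Ph) v = evalp P v * evalp Ph v by exact: mevalM.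
pose V := [set W : line C r | exists2 v, v \in sval W & evalp (P * Ph) v != 0].
(* [Pa] and [Ph] have equal degree, so the quotient does not depend on the vector picked on the
   line; in [V], the factor [P] keeps points in [U] and [Ph] keeps the denominator nonzero. *)
pose q (W : line C r) := evalp Pa (vpick (sval W)) / evalp Ph (vpick (sval W)).
have qE (W : line C r) v : v \in sval W -> v != 0 -> q W = evalp Pa v / evalp Ph v.
  move=> vW v0; have : vpick (sval W) \in sval W by exact: memv_pick.
  rewrite (lineP vW v0) => /vlineP[c ec].
  have c0 : c != 0.
    have := svalP W; rewrite (lineP vW v0) => dv.
    have : vpick <[v]> != 0 by rewrite vpick0 -dimv_eq0 (eqP dv).
    by apply: contraNneq => c0; rewrite ec c0 scale0r.
  rewrite /q (lineP vW v0) ec !(evalp_homog _ _ ha, evalp_homog _ _ hh).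
  by rewrite -mulf_div divff ?mul1r // expf_neq0.
have neq0 v : evalp Ph v != 0 -> v != 0 := evalp_neq0 hh.
exists V, q; split.
- exists [set P * Ph] => [_ ->|W]; first by exists (d + D.+1)%N; exact: dhomogM.
  by split=> [[v vW Pv]|[_ [v [-> vW Pv]]]]; [exists (P * Ph), v|exists v].
- exists w => //; rewrite evalPh mulf_neq0 // (hE _ _ _ xg xw) mulf_neq0 //.
  by rewrite expf_neq0 // (max_chart_neq0 xg xw).
- move=> y [v yv]; rewrite evalPh mulf_eq0 negb_or => /andP[Pv _].
  exact: PU yv Pv.
- move=> W [v vW]; rewrite evalPh mulf_eq0 negb_or => /andP[_ Phv].
  exists D.+1, Pa, Ph; split=> //; first by exists v.
  by move=> W' v' _ v'W v'0 _; exact: qE.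
- move=> y [v yv]; rewrite evalPh mulf_eq0 negb_or => /andP[Pv Phv].
  rewrite (qE _ v) ?neq0 //.
  have vv : v ord0 (vert_idx e) != 0 by apply: contraNneq Phv => /hh0 ->.
  have [g' yg'] := embedding_chart yv vv.
  rewrite (hE _ _ _ yg' yv) in Phv *; rewrite (aE _ _ _ yg' yv).
  move: Phv; rewrite mulf_eq0 negb_or => /andP[v0 hg'].
  by rewrite -mulf_div divff // mul1r (fE y g') //; exact: PU yv Pv.
Qed.

Lemma very_ample : anticanonical_power_very_ample Sigma 1.
Proof.
exists r, (fun i => section_of (pt i)), embedding; split.
- move=> i; have Pm := pt_polytope i.
  split=> [sigma A S [uA [I s]]|sigma A sigma' A' S [uA [I s]] S' [uA' [I' s']] d hd].
    by apply: (@section_coord_ring sigma A I).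
  by rewrite expr1; apply: (@section_transition sigma A I sigma' A' I').
- move=> x sigma g A xg [uA [I s]]; apply: (@embeddingE x sigma g A I) => //.
  by split=> //; have [] := in_chartP xg.
- split.
  + exact: embedding_inj.
  + exact: embedding_closed.
  + move=> V oV; split=> [|f]; first exact: embedding_continuous.
    exact: embedding_regular.
  + exact: embedding_open.
  + by move=> U f oU rf x Ux; exact: embedding_regular_local.
Qed.

End Embedding.

(** * Towers of projective line bundles *)

Lemma neq_negb (b c : bool) : b != c -> b = ~~ c.
Proof. by case: b; case: c. Qed.

Section BottTower.
Variables (R : realType) (n : nat) (g : bool -> 'I_n -> 'rV[int]_n).
Variable rank : 'I_n -> nat.
Local Notation M := ('rV[int]_n).

Hypothesis tower : forall k, g true k + g false k = 0 \/
  exists b j, (rank j < rank k)%N /\ g true k + g false k = g b j.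

Definition selection (e : 'I_n -> bool) : 'M[int]_n := \matrix_(i < n) g (e i) i.

Hypothesis unit_true : selection (fun=> true) \in unitmx.

Lemma row_selection e i : row i (selection e) = g (e i) i.
Proof. exact: rowK. Qed.

Lemma rank_ind (P : 'I_n -> Prop) :
  (forall k, (forall j, (rank j < rank k)%N -> P j) -> P k) -> forall k, P k.
Proof.
move=> h k; have [m] := ubnP (rank k); elim: m k => // m IH k km.
by apply: h => j jk; apply: IH; apply: leq_trans jk _.
Qed.

Lemma tower_flip c k : g (~~ c) k = - g c k \/
  exists b j, (rank j < rank k)%N /\ g (~~ c) k = g b j - g c k.
Proof.
have e : g true k + g false k = g (~~ c) k + g c k by case: c; rewrite // addrC.
have := tower k; rewrite e => -[/eqP|[b [j [jk gb]]]].
  by rewrite addr_eq0 => /eqP ->; left.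
by right; exists b, j; rewrite jk -gb addrK.
Qed.

Lemma selection_span e k : forall b, exists c : M, g b k = c *m selection e.
Proof.
elim/rank_ind: k => k IH b.
have ek : g (e k) k = delta_mx ord0 k *m selection e.
  by rewrite -rowE row_selection.
have [->|/neq_negb ->] := eqVneq b (e k); first by exists (delta_mx ord0 k).
case: (tower_flip (e k) k) => [->|[b' [j [jk ->]]]].
  by exists (- delta_mx ord0 k); rewrite mulNmx ek.
have [c ->] := IH j jk b'.
by exists (c - delta_mx ord0 k); rewrite mulmxBl ek.
Qed.

(** By [selection_span] the unimodular matrix of [unit_true] factors through every selection. *)
Lemma selection_unit e : selection e \in unitmx.
Proof.
pose c k := sval (cid (selection_span e k true)).
have : selection (fun=> true) = (\matrix_(k < n) c k) *m selection e.
  apply/row_matrixP => k; rewrite row_mul row_selection rowK /c.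
  by case: cid.
by move: unit_true => /[swap] ->; rewrite !unitmxE det_mulmx unitrM => /andP[].
Qed.

(** * Vertices and lattice points of the tower polytope *)

Definition vertex_of (e : 'I_n -> bool) : M := - dual_sum (selection e).

Lemma dot_vertex_of e i : dot (vertex_of e) (row i (selection e)) = -1.
Proof. by rewrite dotNl dot_dual_sum // selection_unit. Qed.

(* A functional with values in [-1, 0] on a selection is at least -1 on the  *)
(* other generators, as their sum with selected ones lies lower in the tower. *)
Lemma tower_ge m e : (forall k, -1 <= dot m (g (e k) k) <= 0) ->
  forall k b, -1 <= dot m (g b k).
Proof.
move=> h; elim/rank_ind => k IH b; have /andP[h1 h2] := h k.
have [->//|/neq_negb ->] := eqVneq b (e k).
case: (tower_flip (e k) k) => [->|[b' [j [jk ->]]]].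
  by rewrite dotC dotNl dotC; lia.
by rewrite dotC dotBl !(dotC _ m); have := IH j jk b'; lia.
Qed.

Lemma vertex_of_ge e k b : -1 <= dot (vertex_of e) (g b k).
Proof.
by apply: (tower_ge (e := e)) => {}k; rewrite -row_selection dot_vertex_of.
Qed.

(** The value is 1, or 1 plus the value on a lower generator, which is at least -1. *)
Lemma vertex_of_flip e k : 0 <= dot (vertex_of e) (g (~~ e k) k).
Proof.
have := dot_vertex_of e k; rewrite row_selection => v.
case: (tower_flip (e k) k) => [->|[b' [j [jk ->]]]].
  by rewrite dotC dotNl dotC v.
by rewrite dotC dotBl !(dotC _ (vertex_of e)) v; have := vertex_of_ge e j b'; lia.
Qed.

Lemma vertex_of_sep e e' i :
  (exists j, row i (selection e') = row j (selection e)) \/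
  0 <= dot (vertex_of e) (row i (selection e')).
Proof.
rewrite row_selection; have [->|/neq_negb ->] := eqVneq (e' i) (e i).
  by left; exists i; rewrite row_selection.
right; exact: vertex_of_flip.
Qed.

Local Notation tower_polytope := (polytope selection).

Lemma tower_polytopeP m : tower_polytope m <-> forall k b, -1 <= dot m (g b k).
Proof.
split=> [h k b|h e i]; last by rewrite row_selection.
by have := h (fun=> b) k; rewrite row_selection.
Qed.

Lemma vertex_edge e i :
  tower_polytope (vertex_of e + row i (dual_basis (selection e))).
Proof.
apply/tower_polytopeP; apply: (tower_ge (e := e)) => k.
rewrite -row_selection dotDl dot_vertex_of dot_dual_basis ?selection_unit //.
by case: (i == k).
Qed.

(** If each index has a generator of value -1, these form a selection with vertex m. Otherwise m
    moves both ways along the dual vector at a free index of largest rank, where neither generator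
    is tight; maximality keeps the move from affecting the other free indices. *)
Lemma tower_extremal m : tower_polytope m ->
  (exists e, m = vertex_of e) \/
  exists x, [/\ x != 0, tower_polytope (m + x) & tower_polytope (m - x)].
Proof.
move=> /tower_polytopeP Pm.
pose free k := (dot m (g true k) != -1) && (dot m (g false k) != -1).
pose e k := dot m (g true k) == -1.
have nfree k : ~~ free k -> dot m (g (e k) k) = -1.
  rewrite /free /e; case: (eqVneq (dot m (g true k)) (-1)) => [-> //|_ /=].
  by rewrite negbK => /eqP.
have [k1 fk1|nf] := pickP free; last first.
  left; exists e; apply: (dot_inj (selection_unit e)) => i.
  by rewrite dot_vertex_of row_selection nfree // nf.
right; case: (@arg_maxnP _ k1 free rank fk1) => {fk1}k1 fk maxk.
pose x := row k1 (dual_basis (selection e)).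
have xe j : dot x (g (e j) j) = (k1 == j)%:R.
  by rewrite -row_selection dot_dual_basis ?selection_unit.
have x0 j : forall b, (rank j <= rank k1)%N -> j != k1 -> dot x (g b j) = 0.
  elim/rank_ind: j => j IH b jk jk1.
  have ej : dot x (g (e j) j) = 0 by rewrite xe eq_sym (negPf jk1).
  have [->//|/neq_negb ->] := eqVneq b (e j).
  case: (tower_flip (e j) j) => [->|[b' [i [ij ->]]]].
    by rewrite dotC dotNl dotC ej.
  have ik : (rank i < rank k1)%N := leq_trans ij jk.
  rewrite dotC dotBl !(dotC _ x) ej subr0; apply: IH => //; first exact: ltnW.
  by apply: contraTneq ik => ->; rewrite ltnn.
have x1 b : -1 <= dot x (g b k1) <= 1.
  have ek : dot x (g (e k1) k1) = 1 by rewrite xe eqxx.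
  have [->|/neq_negb ->] := eqVneq b (e k1); first by rewrite ek.
  case: (tower_flip (e k1) k1) => [->|[b' [i [ik ->]]]].
    by rewrite dotC dotNl dotC ek.
  rewrite dotC dotBl !(dotC _ x) ek x0 //; first exact: ltnW.
  by apply: contraTneq ik => ->; rewrite ltnn.
have Ps s : -1 <= s <= 1 -> tower_polytope (m + s *: x).
  move=> hs; apply/tower_polytopeP; elim/rank_ind => j IH b.
  have [fj|nfj] := boolP (free j).
    rewrite dotDl dotZl; have [->|jk] := eqVneq j k1; last first.
      by rewrite x0 ?mulr0 ?addr0 //; exact: maxk.
    have m0 : 0 <= dot m (g b k1).
      have := Pm k1 b; have := fk; rewrite /free.
      by case: b => /andP[? ?]; lia.
    by have := x1 b; nia.
  (* At a tight index the selected value stays -1, so the other is 1, or 1 plus a lower value that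
     is at least -1 by induction. *)
  have jk : k1 != j by apply: contraNneq nfj => <-.
  have ej : dot (m + s *: x) (g (e j) j) = -1.
    by rewrite dotDl dotZl xe (negPf jk) mulr0 addr0 nfree.
  have [->|/neq_negb ->] := eqVneq b (e j); first by rewrite ej.
  case: (tower_flip (e j) j) => [->|[b' [i [ij ->]]]].
    by rewrite dotC dotNl dotC ej.
  by rewrite dotC dotBl !(dotC _ (m + _)) ej; have := IH i ij b'; lia.
exists x; split.
- by apply/eqP => x00; have := xe k1; rewrite x00 dot0l eqxx.
- by rewrite -[x]scale1r; exact: Ps.
- by rewrite -scaleN1r; exact: Ps.
Qed.

(** A generator is a lower one, or 0, minus its partner, whose value is at least -1; each level thus
    adds at most 1. This bounds the polytope. *)
Lemma tower_le m : tower_polytope m ->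
  forall k b, dot m (g b k) <= (rank k).+1%:Z.
Proof.
move=> /tower_polytopeP Pm; elim/rank_ind => k IH b.
have := Pm k (~~ b); have := tower_flip (~~ b) k; rewrite negbK.
case=> [->|[b' [j [jk ->]]]]; first by rewrite [in X in _ -> X]dotC dotNl dotC; lia.
by rewrite [in X in _ -> X]dotC dotBl !(dotC _ m); have := IH j jk b'; lia.
Qed.

Lemma tower_finite : exists r (pt : 'I_r.+1 -> M),
  forall m, tower_polytope m <-> exists i, pt i = m.
Proof.
(* The values on [g true k] run from -1 to the maximal rank plus 1; [F] reads them from ['I_B] after
   a shift by 1. *)
pose B := (\max_k rank k).+3.
pose D k := row k (dual_basis (selection (fun=> true))).
pose F (f : {ffun 'I_n -> 'I_B}) : M := \sum_k ((f k : nat)%:Z - 1) *: D k.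
pose s := [seq F f | f <- enum {ffun 'I_n -> 'I_B} & `[< tower_polytope (F f) >]].
have sP m : tower_polytope m <-> m \in s.
  split=> [Pm|/mapP[f]]; last by rewrite mem_filter => /andP[/asboolP + _] ->.
  have h k : exists i : 'I_B, dot m (g true k) = (i : nat)%:Z - 1.
    have lo : -1 <= dot m (g true k) by move/tower_polytopeP: Pm.
    have hi := tower_le Pm k true.
    have rk : (rank k <= \max_k rank k)%N by exact: leq_bigmax.
    have ib : (`|(dot m (g true k) + 1)%R|%N < B)%N by rewrite /B; lia.
    by exists (Ordinal ib) => /=; lia.
  pose f := [ffun k => sval (cid (h k))].
  have mF : m = F f.
    rewrite {1}(dual_basis_expand (selection_unit (fun=> true)) m).
    apply: eq_bigr => k _; rewrite row_selection ffunE; congr (_ *: _).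
    by case: cid.
  apply/mapP; exists f => //; rewrite mem_filter mem_enum andbT.
  by apply/asboolP; rewrite -mF.
(* The origin makes the list nonempty, as indexing by ['I_r.+1] requires. *)
have s0 : 0 \in s.
  by apply/sP/tower_polytopeP => k b; rewrite dot0l.
have sz : (size s).-1.+1 = size s by case: (s) s0.
exists (size s).-1, (fun i => nth 0 s i) => m; rewrite sP; split.
  move=> ms; have im : (index m s < (size s).-1.+1)%N by rewrite sz index_mem.
  by exists (Ordinal im); rewrite nth_index.
by move=> [i <-]; apply: mem_nth; apply: leq_trans (ltn_ord i) _; rewrite sz.
Qed.

(** * The fan of a tower *)

Definition tower_fan : set (set 'rV[R]_n) :=
  [set sigma | exists Q : set M,
     [/\ forall u, Q u -> exists k, u = g true k \/ u = g false k,
         forall k, ~ (Q (g true k) /\ Q (g false k))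
       & sigma = cone R Q]].

Lemma tower_fan_cone sigma : tower_fan sigma ->
  exists e I, sigma = cone R (rays (selection e) I).
Proof.
move=> [Q [Qg Qn ->]]; pose e k := `[< Q (g true k) >].
exists e, [set k | `[< Q (g (e k) k) >]]%SET.
congr (cone R _); apply/seteqP; split=> u.
  move=> Qu; have [k uk] := Qg u Qu; exists k.
    rewrite finset.inE; apply/asboolP; rewrite /e.
    case: asboolP => [//|nQ]; case: uk => uk; first by rewrite -uk in nQ.
    by rewrite -uk.
  rewrite row_selection /e; case: uk => uk; first by rewrite asboolT -?uk.
  by rewrite asboolF // => Qt; apply: (Qn k); rewrite -uk.
by move=> [k]; rewrite finset.inE => /asboolP + ->; rewrite row_selection.
Qed.

Lemma tower_fan_max e :
  tower_fan (cone R (rays (selection e) (finset.setTfor 'I_n))).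
Proof.
exists (rays (selection e) (finset.setTfor 'I_n)); split=> //.
  move=> u [k _ ->]; exists k; rewrite row_selection.
  by case: (e k); [left|right].
move=> k; suff : ~ rays (selection e) (finset.setTfor 'I_n) (g (~~ e k) k).
  by case: (e k) => /= h [? ?]; apply: h.
by move=> [j _ ek]; have := vertex_of_flip e k; rewrite ek dot_vertex_of.
Qed.

Theorem tower_Fano : is_Fano tower_fan.
Proof.
split=> [sigma /tower_fan_cone[e [I ->]]|].
  by exists (selection e); split; [exact: selection_unit|exists I].
exists 1 => //; have [r [pt ptP]] := tower_finite.
apply: (very_ample selection_unit tower_fan_cone dot_vertex_of vertex_of_sep
  vertex_edge ptP tower_extremal tower_fan_max).
Qed.

End BottTower.

(** * Triangulated polygons *)

Section Polygon.
Variables (n : nat) (T : {set edge n}).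
Hypotheses (n_gt0 : (0 < n)%N) (hT : is_triangulation T).

Lemma edge_lt p : p \in T -> (p.1 < p.2)%N.
Proof. by case: hT => + _ _ _ => /[apply]. Qed.

Lemma side_in p : is_side p -> p \in T.
Proof. by case: hT => _ + _ _ => /[apply]. Qed.

Lemma noncrossing (a b c d : 'I_n.+2) : (a, c) \in T -> (b, d) \in T ->
  (a < b)%N -> (b < c)%N -> (c < d)%N -> False.
Proof.
case: hT => _ _ + _ => nc /nc /[apply] + ab bc cd.
by rewrite /crosses /= ab bc cd.
Qed.

Lemma triangle_unique a b a' b' k : is_triangle T a k b -> is_triangle T a' k b' ->
  a = a' /\ b = b'.
Proof.
move=> [ak kb ab ack kcb] [ak' kb' ab' ack' kcb'].
split; apply: val_inj => /=.
  case: (ltngtP a a') => // h; exfalso.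
    exact: (noncrossing ack ab' h ak' kb').
  exact: (noncrossing ack' ab h ak kb).
case: (ltngtP b b') => // h; exfalso.
  exact: (noncrossing ab kcb' ak kb h).
exact: (noncrossing ab' kcb ak' kb' h).
Qed.

(** * Counting edges and finding triangles *)

Definition edges_in (a b : 'I_n.+2) : {set edge n} :=
  [set p in T | (a <= p.1)%N && (p.2 <= b)%N]%SET.

(** Take for c the largest neighbour of a below b. An edge other than ab that passes over c would
    cross ac or, starting at a, contradict maximality. *)
Lemma edges_in_split (a b : 'I_n.+2) : (a.+1 < b)%N -> exists c : 'I_n.+2,
  [/\ (a < c)%N, (c < b)%N
    & (#|edges_in a b| <= ((a, b) \in T) + #|edges_in a c| + #|edges_in c b|)%N].
Proof.
move=> ab; pose P (c : 'I_n.+2) := [&& (a < c)%N, (c < b)%N & (a, c) \in T].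
have a1 : (a.+1 < n.+2)%N by apply: leq_trans ab (ltnW (ltn_ord b)).
have P1 : P (Ordinal a1).
  by rewrite /P /= leqnn ab side_in // /is_side /= eqxx.
case: (@arg_maxnP _ (Ordinal a1) P (@nat_of_ord _) P1) => c /and3P[ac cb acT] maxc.
exists c; split=> //.
have sub : edges_in a b \subset
    [set p in T | p == (a, b)]%SET :|: edges_in a c :|: edges_in c b.
  apply/fintype.subsetP => -[p q]; rewrite !finset.inE /= => /and3P[pT ap qb].
  rewrite pT ap qb /= !andbT; have pq := edge_lt pT; rewrite /= in pq.
  have [qc|cq] := leqP q c; first by rewrite orbT.
  have [cp|pc] := leqP c p; first by rewrite orbT.
  rewrite !orbF; apply: contraT; rewrite xpair_eqE => npq.
  have pa : p = a.
    apply: val_inj => /=; apply/eqP; rewrite eqn_leq ap andbT leqNgt.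
    by apply/negP => ap'; exact: (noncrossing acT pT ap' pc cq).
  move: pT npq; rewrite pa eqxx /= => aq qb'.
  have : P q by rewrite /P (ltn_trans ac cq) aq ltn_neqAle qb andbT qb'.
  by move=> /maxc qc; have : (q <= c)%N := qc; rewrite leqNgt cq.
apply: leq_trans (subset_leq_card sub) _.
apply: leq_trans (leq_card_setU _ _) _; rewrite leq_add2r.
apply: leq_trans (leq_card_setU _ _) _; rewrite leq_add2r.
case: (boolP ((a, b) \in T)) => abT.
  rewrite -[leqRHS](cards1 (a, b)); apply: subset_leq_card.
  by apply/fintype.subsetP => p; rewrite !finset.inE => /andP[].
rewrite leqn0 cards_eq0; apply/eqP/finset.setP => p; rewrite !finset.inE.
by apply/negP => /andP[pT /eqP e]; rewrite -e pT in abT.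
Qed.

Lemma edges_in_side (a b : 'I_n.+2) : b = a.+1 :> nat -> (#|edges_in a b| <= 1)%N.
Proof.
move=> ba; rewrite -(cards1 (a, b)); apply: subset_leq_card.
apply/fintype.subsetP => -[p q]; rewrite !finset.inE /= => /and3P[pT ap qb].
by have := edge_lt pT; rewrite /= xpair_eqE -!val_eqE /=; lia.
Qed.

Lemma edges_in_lt (a b : 'I_n.+2) : (a < b)%N -> (#|edges_in a b| < 2 * (b - a))%N.
Proof.
have [m] := ubnP (b - a)%N; elim: m a b => // m IH a b lem ab.
have [ab1|ba] := ltnP a.+1 b; last by have := @edges_in_side a b; lia.
have [c [ac cb le]] := edges_in_split ab1.
have ca : (c - a < m)%N by lia.
have bc : (b - c < m)%N by lia.
have := IH a c ca ac; have := IH c b bc cb.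
move: (leq_b1 ((a, b) \in T)) le; move: (nat_of_bool _) => t.
by move: #|_| #|_| #|_| => x y z; lia.
Qed.

(** Equality in [edges_in_lt]: a triangulated polygon on a, ..., b has 2(b - a) - 1 edges. *)
Definition full (a b : 'I_n.+2) := #|edges_in a b|.+1 = (2 * (b - a))%N.

(** Since 2(b - a) - 1 = 1 + (2(c - a) - 1) + (2(b - c) - 1), equality for the whole forces equality
    in both parts and the presence of ab. *)
Lemma full_split (a b : 'I_n.+2) : (a.+1 < b)%N -> full a b ->
  exists c : 'I_n.+2, [/\ (a < c)%N, (c < b)%N, full a c, full c b & (a, b) \in T].
Proof.
rewrite /full => ab f; have [c [ac cb le]] := edges_in_split ab; exists c.
have := edges_in_lt ac; have := edges_in_lt cb.
move: le; move: (leq_b1 ((a, b) \in T)); case: (_ \in T) => /= _.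
  by move: #|_| #|_| #|_| f => x y z f; split=> //; lia.
by move: #|_| #|_| #|_| f => x y z f; lia.
Qed.

Lemma full_in (a b : 'I_n.+2) : (a < b)%N -> full a b -> (a, b) \in T.
Proof.
move=> ab f; have [/full_split /(_ f)[c []]//|ba] := ltnP a.+1 b.
by apply: side_in; rewrite /is_side /= eqn_leq ba ab.
Qed.

Lemma full_top : full ord0 ord_max.
Proof.
have eT : edges_in ord0 ord_max = T.
  by apply/finset.setP => p; rewrite finset.inE /= leq_ord !andbT.
have := @edges_in_lt ord0 ord_max isT; rewrite /full eT /= subn0.
(* Sending i to the side that starts there, and the last vertex to e, exhibits n + 2 sides; with the
   n - 1 diagonals they reach the bound 2n + 1. *)
pose f (i : 'I_n.+2) : edge n :=
  if i == ord_max then (ord0, ord_max) else (i, inord i.+1).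
have lti (i : 'I_n.+2) : i != ord_max -> (i.+1 < n.+2)%N.
  by rewrite -val_eqE /= => ?; have := ltn_ord i; lia.
have injf : injective f.
  have ne (j : 'I_n.+2) : j != ord_max -> (ord0, ord_max) <> (j, inord j.+1) :> edge n.
    move=> /lti j1 [/(congr1 val) /= j0 /(congr1 val) /=].
    by rewrite inordK // -j0; lia.
  move=> i j; rewrite /f; case: eqVneq => [->|ni]; case: eqVneq => [->|nj] //.
  - by move=> /(ne _ nj).
  - by move=> /esym /(ne _ ni).
  - by case.
have sides : (n.+2 <= #|T :&: [set p | is_side p]%SET|)%N.
  apply: (@leq_trans #|f @: 'I_n.+2|); first by rewrite card_imset // card_ord.
  apply/subset_leq_card/fintype.subsetP => _ /imsetP[i _ ->].
  have sf : is_side (f i).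
    rewrite /is_side /f; case: (eqVneq i ord_max) => [_|/lti i1].
      by rewrite eqxx orbT.
    by rewrite /= inordK // eqxx.
  by rewrite !finset.inE sf side_in.
have diag : #|T :\: [set p | is_side p]%SET| = n.-1.
  case: hT => _ _ _ <-; apply: eq_card => p.
  by rewrite !finset.inE andbC.
have := cardsID [set p | is_side p]%SET T; rewrite diag => <-.
by move: #|_| sides n_gt0 => t; rewrite /=; lia.
Qed.

(** Follow the recursion from e: a full distinguished edge splits at some c, and unless c is k the
    search continues in the part containing k. *)
Lemma triangle_exists (k : 'I_n.+2) : (0 < k)%N -> (k < n.+1)%N ->
  exists a b, distinguished T a b /\ is_triangle T a k b.
Proof.
suff h (m : nat) (a b : 'I_n.+2) : (b - a < m)%N -> full a b -> distinguished T a b ->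
    (a < k)%N -> (k < b)%N -> exists a b, distinguished T a b /\ is_triangle T a k b.
  by move=> k0 kn; apply: (h n.+2 ord0 ord_max _ full_top (dist_e T)); rewrite //= subn0.
elim: m a b => // m IH a b lem f d ak kb.
have [c [ac cb fac fcb abT]] := full_split (leq_ltn_trans ak kb) f.
have tri : is_triangle T a c b by split=> //; exact: full_in.
case: (ltngtP k c) => [kc|ck|/val_inj ->]; last by exists a, b.
- by apply: (IH a c _ fac (dist_L d tri)); lia.
- by apply: (IH c b _ fcb (dist_R d tri)); lia.
Qed.

Lemma leftv_triangle a k b : distinguished T a b -> is_triangle T a k b ->
  leftv T k = a.
Proof.
move=> d t; have [|_ [b' _ t']] := @xgetPex _ ord0
    [set j : 'I_n.+2 | (j < k)%N /\ labelled_L T j k].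
  by exists a; split; [case: t|exists b].
exact: (triangle_unique t' t).1.
Qed.

Lemma rightv_triangle a k b : distinguished T a b -> is_triangle T a k b ->
  rightv T k = b.
Proof.
move=> d t; have [|_ [a' _ t']] := @xgetPex _ ord0
    [set j : 'I_n.+2 | (k < j)%N /\ labelled_R T k j].
  by exists b; split; [case: t|exists a].
exact: (triangle_unique t' t).2.
Qed.

Lemma val_vertex (k : 'I_n) : vertex k = k.+1 :> nat.
Proof. by rewrite inordK // !ltnS ltnW. Qed.

Lemma vertex_surj (x : 'I_n.+2) : (0 < x)%N -> (x < n.+1)%N -> exists k, x = vertex k.
Proof.
move=> x0 xn; have h : (x.-1 < n)%N by lia.
by exists (Ordinal h); apply: val_inj; rewrite /= val_vertex /= prednK.
Qed.

Lemma vertex_triangle k : distinguished T (leftv T (vertex k)) (rightv T (vertex k)) /\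
  is_triangle T (leftv T (vertex k)) (vertex k) (rightv T (vertex k)).
Proof.
have k0 : (0 < vertex k)%N by rewrite val_vertex.
have kn : (vertex k < n.+1)%N by rewrite val_vertex ltnS.
have [a [b [d t]]] := triangle_exists k0 kn.
by rewrite (leftv_triangle d t) (rightv_triangle d t).
Qed.

(** * The rays as a tower *)

Lemma varpiE i l : varpi n i ord0 l = (i == l.+1)%:R.
Proof.
have e (k : 'I_n.+1) :
    (\sum_(j < n.+1 | (j < i)%N) delta_mx ord0 j : 'rV[int]_n.+1) ord0 k = (k < i)%:R.
  rewrite summxE; have [ki|ik] := boolP (k < i)%N.
    rewrite (bigD1 k) //= mxE !eqxx big1 ?addr0 // => j /andP[_ jk].
    by rewrite mxE eq_sym (negPf jk) andbF.
  rewrite big1 // => j ji; rewrite mxE; case: eqP => //= _.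
  by case: eqP => // kj; rewrite kj ji in ik.
rewrite mxE !e /= /bump leq0n add1n; have [->|ne] := eqVneq i l.+1.
  by rewrite ltnn leqnn subr0.
by rewrite (leq_eqVlt l.+1) eq_sym (negPf ne) subrr.
Qed.

Definition ray (b : bool) := if b then vvec T else wvec T.
(** Wider bases have smaller depth, so passing to the next triangle up lowers the rank. *)
Definition depth k := (n.+1 - (rightv T (vertex k) - leftv T (vertex k)))%N.

Lemma varpi_max : varpi n (ord_max : 'I_n.+2) = 0.
Proof. by apply/rowP => l; rewrite varpiE mxE eqSS gtn_eqF. Qed.

Lemma varpi0 : varpi n (ord0 : 'I_n.+2) = 0.
Proof. by apply/rowP => l; rewrite varpiE mxE. Qed.

Lemma distinguishedP a b : distinguished T a b ->
  [\/ (a = ord0 /\ b = ord_max),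
      exists2 c, distinguished T a c & is_triangle T a b c
    | exists2 c, distinguished T c b & is_triangle T c a b].
Proof.
case=> [|{}a c {}b d t|c {}a {}b d t]; first exact: Or31.
  by apply: Or32; exists b.
by apply: Or33; exists c.
Qed.

(* The triangle at k lies below its base {k_L, k_R}, and the base is a leg of *)
(* the next triangle up unless it is e.                                      *)
Lemma ray_tower k : ray true k + ray false k = 0 \/
  exists b j, (depth j < depth k)%N /\ ray true k + ray false k = ray b j.
Proof.
have [d [ak kb _ _ _]] := vertex_triangle k.
have -> : ray true k + ray false k =
    varpi n (leftv T (vertex k)) - varpi n (rightv T (vertex k)).
  by rewrite /ray /vvec /wvec addrC addrA subrK.
rewrite /depth; move: (leftv _ _) (rightv _ _) d ak kb => a b d ak kb.
case/distinguishedP: d => [[-> ->]|[c d t]|[c d t]].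
- by left; rewrite varpi_max varpi0 subrr.
- right; have [ab bc _ _ _] := t.
  have [j bj] : exists j, b = vertex j.
    by apply: vertex_surj; have := ltn_ord c; lia.
  exists false, j; rewrite /ray /wvec -bj (leftv_triangle d t) (rightv_triangle d t).
  by split=> //; have := ltn_ord c; lia.
- right; have [ca ab _ _ _] := t.
  have [j aj] : exists j, a = vertex j.
    by apply: vertex_surj; have := ltn_ord b; lia.
  exists true, j; rewrite /ray /vvec -aj (leftv_triangle d t) (rightv_triangle d t).
  by split=> //; have := ltn_ord b; lia.
Qed.

Lemma vvec_unit : selection ray (fun=> true) \in unitmx.
Proof.
have vE k l : selection ray (fun=> true) k l =
    (k == l)%:R - (rightv T (vertex k) == l.+1 :> nat)%:R.
  rewrite [LHS]mxE /ray /vvec [LHS]mxE [X in _ + X]mxE !varpiE.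
  by rewrite val_vertex eqSS.
have kR (k : 'I_n) : (k.+1 < rightv T (vertex k))%N.
  by have [_ [_ + _ _ _]] := vertex_triangle k; rewrite val_vertex.
(* As k_R > k, the matrix is upper triangular with unit diagonal; the transpose brings it to the
   lower triangular form of [det_trig]. *)
rewrite -unitmx_tr unitmxE det_trig.
  rewrite big1 ?unitr1 // => k _; rewrite mxE vE eqxx gtn_eqF ?subr0 //.
apply/is_trig_mxP => k l kl; rewrite mxE vE.
have -> : (l == k) = false by rewrite -val_eqE gtn_eqF.
by rewrite gtn_eqF ?subrr //; have := kR l; lia.
Qed.

End Polygon.

Theorem lemma6p5 (R : realType) (n : nat) (hn : (1 <= n)%N)
    (T : {set edge n}) (hT : is_triangulation T) :
  is_Fano (fanT R T).
(* [fanT] is convertible to [tower_fan] for the family [ray]. *)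
Proof. exact: (tower_Fano R (ray_tower hn hT) (vvec_unit hn hT)). Qed.
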